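(* Let $N\ge 1$, $0<\ell<N$, $1<q<\infty$, and let $u,v$ be nonnegative functions in $L^1_{loc}(\mathbb{R}^N)$. There exists a constant $C>0$ such that $$\left(\int_{\mathbb{R}^N}|I_\ell f(x)|^q\,u(x)\,dx\right)^{1/q}\le C\int_{\mathbb{R}^N}|f(x)|\,v(x)\,dx\qquad\text{for all } f\in C_c^\infty(\mathbb{R}^N)$$ if and only if there exists a constant $\widetilde C>0$ such that $$\left(\int_{\mathbb{R}^N}\frac{u(x)}{|x-y|^{(N-\ell)q}}\,dx\right)^{1/q}\le\widetilde C\,v(y)\qquad\text{for almost every } y\in\mathbb{R}^N .$$
   Context: For $0<\ell<N$ the Riesz potential is $I_\ell f(x)=\gamma_{N,\ell}\int_{\mathbb{R}^N}\frac{f(y)}{|x-y|^{N-\ell}}\,dy$ with $\gamma_{N,\ell}=\pi^{\ell-N/2}\,\Gamma((N-\ell)/2)/\Gamma(\ell/2)$. *)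

(* Defs.v *)
From HB Require Import structures.
From mathcomp Require Import all_boot all_order all_algebra.
From mathcomp Require Import all_classical all_reals all_analysis.

Set Implicit Arguments.
Unset Strict Implicit.
Unset Printing Implicit Defensive.
Import Order.TTheory GRing.Theory Num.Theory.
Import numFieldNormedType.Exports.
Local Open Scope classical_set_scope.
Local Open Scope ring_scope.

(* The Euclidean space R^n is the type 'rV[R]_n. Its topology is the library's
   one; its norm `|x| is the sup norm, hence the separate [enorm] below. *)

Section measurable_rV.
Context {d} {T : measurableType d}.
Variable n : nat.

Let coors : 'I_n -> 'rV[T]_n -> T := fun i x => x ord0 i.

Let rV_set0 : g_sigma_preimage coors set0.
Proof. exact: sigma_algebra0. Qed.

Let rV_setC A : g_sigma_preimage coors A -> g_sigma_preimage coors (~` A).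
Proof. exact: sigma_algebraC. Qed.

Let rV_bigcup (F : _^nat) : (forall i, g_sigma_preimage coors (F i)) ->
  g_sigma_preimage coors (\bigcup_i (F i)).
Proof. exact: sigma_algebra_bigcup. Qed.

(* The product sigma-algebra, as the library does for n.-tuple T. *)
HB.instance Definition _ := @isMeasurable.Build (measure_tuple_display d)
  'rV[T]_n (g_sigma_preimage coors) rV_set0 rV_setC rV_bigcup.

Lemma measurable_coord (i : 'I_n) :
  measurable_fun [set: 'rV[T]_n] (fun x : 'rV[T]_n => x ord0 i).
Proof.
move=> _ Y mY; rewrite setTI; apply: sub_sigma_algebra => /=.
rewrite -bigcup_seq/=; exists i => /=; first by rewrite mem_index_enum.
by exists Y => //; rewrite setTI.
Qed.

Lemma measurable_fun_rVP d1 (T1 : measurableType d1) (f : T1 -> 'rV[T]_n) :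
  (forall i, measurable_fun [set: T1] (fun x => f x ord0 i)) ->
  measurable_fun [set: T1] f.
Proof.
move=> mf _ Y mY; rewrite setTI.
have mE : [set A | measurable (f @^-1` A)] Y; last exact: mE.
move: Y mY; apply: smallest_sub.
  split => [|A /= mA|F /= mF].
  - by rewrite /= preimage_set0.
  - by rewrite setTD preimage_setC; exact: measurableC.
  - by rewrite preimage_bigcup; exact: bigcupT_measurable.
rewrite -bigcup_seq => A [i _ [B mB <-]] /=.
by rewrite setTI -comp_preimage -[X in measurable X]setTI; exact: mf.
Qed.

End measurable_rV.

Section lebesgue_rV.
Context {R : realType}.

Definition rV_cons n (p : R * 'rV[R]_n) : 'rV[R]_n.+1 :=
  \row_i oapp (p.2 ord0) p.1 (unlift ord0 i).

Definition rV_uncons n (x : 'rV[R]_n.+1) : R * 'rV[R]_n :=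
  (x ord0 ord0, \row_i x ord0 (lift ord0 i)).

Lemma rV_consK n : cancel (@rV_cons n) (@rV_uncons n).
Proof.
move=> p; rewrite /rV_uncons [RHS]surjective_pairing mxE unlift_none.
by congr pair; apply/rowP => i; rewrite !mxE liftK.
Qed.

Lemma measurable_rV_cons n : measurable_fun setT (@rV_cons n).
Proof.
apply: measurable_fun_rVP => i; under eq_fun do rewrite mxE.
case: (unliftP ord0 i) => [j _|_] /=; last exact: measurable_fst.
apply: (measurableT_comp (measurable_coord j)); exact: measurable_snd.
Qed.

Lemma measurable_rV_uncons n : measurable_fun setT (@rV_uncons n).
Proof.
apply/measurable_fun_pairP; split; first exact: measurable_coord.
apply: measurable_fun_rVP => i /=; under eq_fun do rewrite mxE.
exact: measurable_coord.
Qed.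

Section step.
Variables (n : nat) (m : {sigma_finite_measure set 'rV[R]_n -> \bar R}).

Definition lebesgue_rV_step : set 'rV[R]_n.+1 -> \bar R :=
  pushforward (@lebesgue_measure R \x m)%E (@rV_cons n).

Let step0 : lebesgue_rV_step set0 = 0%E.
Proof. by rewrite /lebesgue_rV_step /pushforward preimage_set0 measure0. Qed.

Let step_ge0 A : (0 <= lebesgue_rV_step A)%E.
Proof. by rewrite /lebesgue_rV_step /pushforward measure_ge0. Qed.

Let step_sigma_additive : semi_sigma_additive lebesgue_rV_step.
Proof.
have mf := @measurable_rV_cons n.
exact: (measure_semi_sigma_additive
  (s := pushforward (@lebesgue_measure R \x m)%E (@rV_cons n))).
Qed.

HB.instance Definition _ := isMeasure.Build _ _ _ lebesgue_rV_step
  step0 step_ge0 step_sigma_additive.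

Let step_sigma_finite : sigma_finite setT lebesgue_rV_step.
Proof.
have /sigma_finiteP[F [TF ndF Foo]] := sigma_finiteT (@lebesgue_measure R).
have /sigma_finiteP[G [TG ndG Goo]] := sigma_finiteT m.
exists (fun k => @rV_uncons n @^-1` (F k `*` G k)).
  apply/esym; rewrite -preimage_bigcup -subTset => x _.
  have [[i _ Fi] [j _ Gj]] : (\bigcup_k F k) (rV_uncons x).1 /\
      (\bigcup_k G k) (rV_uncons x).2 by rewrite -TF -TG.
  exists (maxn i j) => //; split.
    by move: Fi; exact/subsetPset/ndF/leq_maxl.
  by move: Gj; exact/subsetPset/ndG/leq_maxr.
move=> k; have [mF Fk] := Foo k; have [mG Gk] := Goo k; split.
  rewrite -[X in measurable X]setTI; apply: measurable_rV_uncons => //.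
  exact: measurableX.
rewrite /lebesgue_rV_step /pushforward -comp_preimage.
rewrite (_ : _ \o _ = id); last by apply/funext; exact: rV_consK.
by rewrite preimage_id product_measure1E// lte_mul_pinfty// ge0_fin_numE.
Qed.

HB.instance Definition _ := Measure_isSigmaFinite.Build _ _ _ lebesgue_rV_step
  step_sigma_finite.

End step.

(* n-fold product of the one-dimensional Lebesgue measure, on Borel sets. *)
Fixpoint product_lebesgue n : {sigma_finite_measure set 'rV[R]_n -> \bar R} :=
  if n is n'.+1 then lebesgue_rV_step (product_lebesgue n') else \d_(0 : 'rV[R]_0).

(* Lebesgue measure on R^n. Through the completion, "measurable" and "almost
   every" are meant with respect to the Lebesgue sigma-algebra, not only to the
   Borel one. *)
Definition lebesgue_rV n := @completed_measure_extension _ _ _ (product_lebesgue n).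

HB.instance Definition _ n := Measure.on (@lebesgue_rV n).
HB.instance Definition _ n := @Measure_isSigmaFinite.Build _ _ _ (@lebesgue_rV n)
  (completed_measure_extension_sigma_finite (sigma_finiteT (product_lebesgue n))).

Lemma product_lebesgue_box n (A : 'I_n -> set R) :
  (forall i, measurable (A i)) ->
  measurable [set x : 'rV[R]_n | forall i, A i (x ord0 i)] /\
  product_lebesgue n [set x | forall i, A i (x ord0 i)] =
    (\prod_(i < n) lebesgue_measure (A i))%E.
Proof.
elim: n A => [|n IHn] A mA.
  rewrite (_ : mkset _ = setT); last by apply/seteqP; split=> // x _ [].
  by split=> //; rewrite big_ord0 /= diracE mem_set// => -[].
have [mB muB] := IHn (fun i => A (lift ord0 i)) (fun i => mA _).
set B : set 'rV[R]_n := mkset _ in mB.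
have E : @rV_uncons n @^-1` (A ord0 `*` B) =
    [set x | forall i, A i (x ord0 i)].
  apply/seteqP; split=> x /=.
    move=> [A0 BS] i; have [j ->|->//] := unliftP ord0 i.
    by have := BS j; rewrite mxE.
  by move=> Ax; split=> [|i]; rewrite ?mxE.
split.
  rewrite -E -[X in measurable X]setTI; apply: measurable_rV_uncons => //.
  exact: measurableX.
rewrite -E /= /lebesgue_rV_step /pushforward -comp_preimage.
rewrite (_ : _ \o _ = id); last by apply/funext; exact: rV_consK.
rewrite preimage_id product_measure1E//; last exact: mA.
rewrite big_ord_recl.
by have -> : product_lebesgue n B = _ := muB.
Qed.

Lemma lebesgue_rV_box n (A : 'I_n -> set R) : (forall i, measurable (A i)) ->
  lebesgue_rV [set x : 'rV[R]_n | forall i, A i (x ord0 i)] =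
    (\prod_(i < n) lebesgue_measure (A i))%E.
Proof.
move=> mA; have [mB muB] := product_lebesgue_box mA.
by rewrite -muB; exact: (measurable_mu_extE (product_lebesgue n)).
Qed.

End lebesgue_rV.
Arguments lebesgue_rV {R} n.

Section riesz.
Context {R : realType}.

Definition enorm n (x : 'rV[R]_n) : R := Num.sqrt (\sum_i x ord0 i ^+ 2).

Definition Gamma (s : R) : R :=
  \int[lebesgue_measure]_(t in `]0, +oo[) (t `^ (s - 1) * expR (- t)).

Definition riesz_cst (N : nat) (l : R) : R :=
  pi `^ (l - N%:R / 2) * Gamma ((N%:R - l) / 2) / Gamma (l / 2).

(* Extended-real valued, so that no convergence is presupposed. Here and
   wherever else the kernel occurs, it takes the value 0 at x = y (division by
   0), a null set for N >= 1. *)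
Definition riesz N (l : R) (f : 'rV[R]_N -> R) (x : 'rV[R]_N) : \bar R :=
  ((riesz_cst N l)%:E *
   \int[lebesgue_rV N]_y (f y / enorm (x - y) `^ (N%:R - l))%:E)%E.

Definition locally_integrable_rV N (u : 'rV[R]_N -> R) : Prop :=
  measurable_fun [set: caratheodory_type (product_lebesgue N)^*%mu] u /\
  forall K : set 'rV[R]_N, compact K ->
    (\int[lebesgue_rV N]_(x in K) `|u x|%:E < +oo)%E.

(* iter_partial [:: i1; ...; ik] f is the partial derivative
   d_i1 (... (d_ik f)). *)
Definition iter_partial N (s : seq 'I_N) (f : 'rV[R]_N -> R) : 'rV[R]_N -> R :=
  foldr (fun i g x => 'D_(delta_mx ord0 i) g x) f s.

Definition smooth N (f : 'rV[R]_N -> R) : Prop :=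
  forall s : seq 'I_N, continuous (iter_partial s f) /\
    forall i x, derivable (iter_partial s f) x (delta_mx ord0 i).

Definition test_function N (f : 'rV[R]_N -> R) : Prop :=
  smooth f /\ compact (closure [set x | f x != 0]).

End riesz.

(* Main.v *)
(* The condition bounds the L^q(u) norms of the columns of the kernel
   k(x, y) = |x - y|^(l - N) by v(y).

   Sufficiency is Minkowski's integral inequality: Hoelder's inequality for the
   measure |f| w dy gives (int |f| k dy)^q <= (int |f| w)^(q-1) int |f| w^(1-q)
   k^q dy, and one integrates against u by Tonelli.

   Necessity avoids the Lebesgue differentiation theorem. If f >= 0 is supported
   in a small cube Q, then I_l f(x) >= gamma (int f) inf_(y in Q) k(x, y), so the
   hypothesis bounds K_Q int f by a multiple of int f v, where K_Q is the L^q(u)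
   norm of the infimum. Such f are dense enough to turn this into a pointwise
   inequality K_Q <= c v almost everywhere on Q. Only countably many cubes are
   needed, and Fatou's lemma applies when Q shrinks to a point. *)

Require Import Defs.
From mathcomp Require Import all_boot all_order all_algebra.
From mathcomp Require Import ring lra.
From mathcomp Require Import all_classical all_reals all_analysis measurable_realfun.
Import Order.TTheory GRing.Theory Num.Theory.
Import numFieldNormedType.Exports.
Set Implicit Arguments.
Unset Strict Implicit.
Unset Printing Implicit Defensive.
Local Open Scope classical_set_scope.
Local Open Scope ring_scope.

(** * The constant of the Riesz potential *)

(** In the necessity part the cutoff to Q is carried by the weight. With [phi] a bump on Q, the
    hypothesis says that the integrable function [phi * (C * v - gamma * K_Q)] has a nonnegative
    integral against every [0,1]-valued [g] of an algebra chosen so that [g * phi] is a test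
    function. As [v] is only Lebesgue measurable, the set where the weight is negative is first
    enlarged to a Borel set by a null set. Three further obstacles shape the details. K_Q may be
    infinite a priori, so it enters through finite truncations. The kernel is 0 on the diagonal,
    where the bound below by the infimum over Q fails, so the diagonal is removed as a null set.
    Finally, dividing by the Riesz constant requires it to be positive: [Gamma] is real valued and
    would be 0 if its integral diverged, so convergence has to be proved. *)

Lemma powR_le_expR (R : realType) (a y : R) : 0 < a -> 0 <= y ->
  y `^ a <= a `^ a * expR y.
Proof.
move=> a0 y0.
(* The bound is [y / a <= expR (y / a)] raised to the power [a]. *)
have -> : expR y = expR (y / a) `^ a.
  by rewrite /powR gt_eqF ?expR_gt0// expRK mulrC divfK ?gt_eqF.
rewrite -powRM ?expR_ge0 ?(ltW a0)//.
apply: ge0_ler_powR; rewrite ?nnegrE ?(ltW a0)// ?mulr_ge0 ?expR_ge0 ?(ltW a0)//.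
rewrite mulrC -ler_pdivrMr//.
by apply: le_trans (expR_ge1Dx _); rewrite lerDr.
Qed.

Section gamma.
Context {R : realType}.
Implicit Types s t : R.
Local Notation leb := (@lebesgue_measure R).

(* [g s] is the derivative of the bounded function [G s] and dominates the
   integrand of [Gamma s] up to a constant factor. *)
Let g s t : R := s * (t / (1 + t)) `^ (s - 1) * (1 + t)^-1 ^+ 2.
Let G s t : R := (t / (1 + t)) `^ s.

Let is_derive_G s t : 0 < t -> is_derive t 1 (G s) (g s t).
Proof.
move=> t0.
have t10 : 1 + t != 0 by rewrite gt_eqF// addr_gt0.
have dh : is_derive t 1 (fun t => t / (1 + t)) ((1 + t)^-1 ^+ 2).
  have -> : (fun t : R => t / (1 + t)) = id * (fun t : R => (1 + t)^-1) by [].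
  have d1 : is_derive t 1 (fun t : R => 1 + t) 1.
    have -> : (fun t : R => 1 + t) = cst 1 + id by [].
    by apply: is_derive_eq; rewrite add0r.
  have dV : is_derive t 1 (fun t : R => (1 + t)^-1) (- (1 + t)^-2).
    have := @is_deriveV _ (fun t : R => 1 + t) t 1 1 t10 d1.
    by rewrite /GRing.scale/= mulr1.
  apply: is_derive_eq; rewrite /GRing.scale/= -exprVn.
  by field.
have := @is_derive1_comp _ (fun x => x `^ s) (fun t => t / (1 + t)) t _ _ _ dh.
apply; apply: is_derive1_powR; exact: divr_gt0 t0 (addr_gt0 ltr01 t0).
Qed.

(** Writing [t = (t / (1 + t)) * (1 + t)] reduces the claim to a bound on
    [(1 + t) ^ (s + 1) * exp (- t)]. [powR_le_expR] at [1 + t] bounds it by [(s + 1) ^ (s + 1) * e];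
    the two extra powers of [1 + t] give the factor [(1 + t) ^ -2] of [g], and [1 / s] cancels the
    factor [s]. *)
Let gamma_integrand_le s t : 0 < s -> 0 < t ->
  t `^ (s - 1) * expR (- t) <= ((s + 1) `^ (s + 1) * expR 1 / s) * g s t.
Proof.
move=> s0 t0; have t10 : 0 < 1 + t by rewrite addr_gt0.
rewrite /g.
have h := @powR_le_expR R (s + 1) (1 + t) (addr_gt0 s0 ltr01) (ltW t10).
have e : t `^ (s - 1) = (t / (1 + t)) `^ (s - 1) * (1 + t) `^ (s - 1).
  by rewrite -powRM ?divfK ?gt_eqF// ?divr_ge0 ?ltW.
have e2 : (1 + t) `^ (s + 1) = (1 + t) `^ (s - 1) * (1 + t) ^+ 2.
  rewrite -powR_mulrn ?(ltW t10)// -powRD; last by rewrite (gt_eqF t10) implybT.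
  by congr (_ `^ _); ring.
rewrite e.
rewrite [leRHS](_ : _ = (t / (1 + t)) `^ (s - 1) *
  (((s + 1) `^ (s + 1) * expR 1) * (1 + t)^-1 ^+ 2)); last first.
  by field; rewrite !gt_eqF.
rewrite -mulrA ler_wpM2l ?powR_ge0//.
rewrite exprVn ler_pdivlMr ?exprn_gt0//.
rewrite mulrAC -e2 expRN ler_pdivrMr ?expR_gt0//.
by rewrite -mulrA -expRD.
Qed.

Let measurable_gamma_integrand s (D : set R) :
  measurable_fun D (fun t : R => t `^ (s - 1) * expR (- t)).
Proof.
apply: measurable_funM.
  apply: measurable_funTS; exact: measurable_powR.
apply: measurable_funTS; apply: measurableT_comp; first exact: measurable_expR.
exact: measurable_funN.
Qed.

Let gamma_integrand_ge0 s t : 0 <= t `^ (s - 1) * expR (- t).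
Proof. by rewrite mulr_ge0 ?powR_ge0 ?expR_ge0. Qed.

Let g_ge0 s t : 0 < s -> 0 <= g s t.
Proof.
by move=> s0; rewrite /g mulr_ge0 ?sqr_ge0// mulr_ge0 ?powR_ge0// ltW.
Qed.

Let g_cont s t : 0 < t -> {for t, continuous (g s)}.
Proof.
move=> t0; have t10 : 1 + t != 0 by rewrite gt_eqF// addr_gt0.
have cV : {for t, continuous (fun t : R => (1 + t)^-1)}.
  apply: continuousV => //; apply: continuousD => //; exact: cst_continuous.
have cq : {for t, continuous (fun t : R => t / (1 + t))} by apply: continuousM.
apply: continuousM; last by apply: continuousM.
apply: continuousM; first exact: cst_continuous.
apply: (@continuous_comp _ _ _ (fun t : R => t / (1 + t)) (fun x => x `^ (s - 1))) => //.
apply: differentiable_continuous; apply/derivable1_diffP.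
by apply: derivable_powR; rewrite in_itv/= andbT divr_gt0// addr_gt0.
Qed.

Let g_integral s (a : R) : 0 < s -> 0 < a ->
  (\int[leb]_(t in `[a, +oo[) (g s t)%:E <= 1)%E.
Proof.
move=> s0 a0.
rewrite (@ge0_continuous_FTC2y R (g s) (G s) a 1).
- by rewrite -EFinB lee_fin gerBl powR_ge0.
- by move=> x _; exact: g_ge0.
- rewrite continuous_subspace_in => x; rewrite inE/= in_itv/= andbT => ax.
  apply: continuous_subspaceT_for; first by rewrite /= in_itv/= andbT.
  by apply: g_cont; exact: lt_le_trans ax.
- suff : G s x @[x --> +oo] --> (1 : R) `^ s by rewrite powR1.
  rewrite /G.
  apply: (@cvg_comp _ _ _ (fun t : R => t / (1 + t)) (fun x => x `^ s) _ (nbhs (1:R))).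
    apply/cvgrPdist_lt => e e0; near=> t.
    have t0 : 0 < t by near: t; exact: nbhs_pinfty_gt.
    have t10 : 0 < 1 + t by rewrite addr_gt0.
    have -> : 1 - t / (1 + t) = (1 + t)^-1 by field; rewrite gt_eqF.
    rewrite ger0_norm ?invr_ge0 ?(ltW t10)// invf_plt ?posrE//.
    have : e^-1 < t by near: t; apply: nbhs_pinfty_gt; rewrite num_real.
    by move/lt_trans; apply; rewrite ltrDr.
  have : {for (1 : R), continuous (fun x : R => x `^ s)}.
    apply: differentiable_continuous; apply/derivable1_diffP.
    by apply: derivable_powR; rewrite in_itv/= andbT.
  exact.
- by move=> x ax; have [] := is_derive_G s (lt_trans a0 ax).
- apply: cvg_at_right_filter; apply: differentiable_continuous.
  by apply/derivable1_diffP; have [] := is_derive_G s a0.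
- move=> x; rewrite in_itv/= andbT => ax; rewrite derive1E.
  by have := is_derive_G s (lt_trans a0 ax) => d; exact: derive_val.
Unshelve. all: by end_near. Qed.

(** [G s] takes values in [0,1] on the positive axis, so the integrals over the half-lines starting
    at [n.+1^-1] have a bound independent of [n], and monotone convergence concludes. Starting away
    from 0 keeps the fundamental theorem applicable: [g s] is unbounded near 0 when [s < 1]. *)
Lemma gamma_fin s : 0 < s ->
  (\int[leb]_(t in `]0%R, +oo[) (t `^ (s - 1) * expR (- t))%:E < +oo)%E.
Proof.
move=> s0; set f := fun t : R => (t `^ (s - 1) * expR (- t))%:E.
pose F (n : nat) : set R := [set` `[n.+1%:R^-1, +oo[].
have FE : `]0, +oo[%classic = \bigcup_n F n.
  apply/seteqP; split => t /=; rewrite in_itv/= andbT.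
    move=> t0; exists (Num.truncn t^-1) => //=; rewrite /F/= in_itv/= andbT.
    by rewrite invf_ple ?posrE// ltW// truncnS_gt.
  by case=> n _; rewrite /F/= in_itv/= andbT; apply: lt_le_trans; rewrite invr_gt0.
have cv : (\int[leb]_(t in F n) f t)%E @[n --> \oo] --> (\int[leb]_(t in \bigcup_n F n) f t)%E.
  apply: ge0_nondecreasing_set_cvg_integral.
  - apply/nondecreasing_seqP => n; rewrite subsetEset => t /=.
    rewrite /F /= !in_itv/= !andbT; apply: le_trans.
    by rewrite lef_pV2 ?posrE// ler_nat.
  - by move=> n; exact: measurable_itv.
  - by move=> n; apply/measurable_EFinP; exact: measurable_gamma_integrand.
  - by move=> n x _; rewrite lee_fin.
rewrite FE; set c := ((s + 1) `^ (s + 1) * expR 1 / s).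
apply: (@le_lt_trans _ _ c%:E); last exact: ltry.
have <- := cvg_lim _ cv => //.
apply: lime_le; first by apply/cvg_ex; eexists; exact: cv.
apply: nearW => n.
have n0 : 0 < n.+1%:R^-1 :> R by rewrite invr_gt0.
have mg : measurable_fun (F n) (g s).
  apply: subspace_continuous_measurable_fun; first exact: measurable_itv.
  rewrite continuous_subspace_in => x; rewrite inE /F/= in_itv/= andbT => ax.
  apply: continuous_subspaceT_for; first by rewrite /= in_itv/= andbT.
  by apply: g_cont; exact: lt_le_trans ax.
have c0 : 0 <= c by rewrite /c !mulr_ge0 ?powR_ge0 ?expR_ge0 ?invr_ge0 ?(ltW s0).
apply: (@le_trans _ _ (\int[leb]_(t in F n) (c%:E * (g s t)%:E))%E).
  apply: ge0_le_integral.
  - exact: measurable_itv.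
  - by move=> x _; rewrite lee_fin.
  - by apply/measurable_EFinP; exact: measurable_gamma_integrand.
  - by apply: measurable_funeM; exact/measurable_EFinP.
  - move=> x; rewrite /F/= in_itv/= andbT => nx; rewrite -EFinM lee_fin.
    by apply: gamma_integrand_le => //; exact: lt_le_trans nx.
rewrite ge0_integralZl//.
- by rewrite -[leRHS]mule1; apply: lee_wpmul2l => //; exact: g_integral.
- exact: measurable_itv.
- exact/measurable_EFinP.
- by move=> x _; rewrite lee_fin; exact: g_ge0.
Qed.

(** [Rintegral] applies [fine], which sends [+oo] to 0; hence positivity rests on [gamma_fin] as
    well as on a lower bound for the integrand. *)
Lemma Gamma_gt0 s : 0 < s -> 0 < Gamma s.
Proof.
move=> s0; rewrite /Gamma /Rintegral; apply: fine_gt0; rewrite gamma_fin// andbT.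
(* A lower bound on [1,2]: [t ^ (s - 1)] is monotone in [t], so it is at least the smaller of its
   values at 1 and 2. *)
pose c : R := Num.min 1 (2 `^ (s - 1)) * expR (- 2).
have c0 : 0 < c by rewrite mulr_gt0 ?expR_gt0// lt_min ltr01 powR_gt0.
apply: (@lt_le_trans _ _ (\int[leb]_(t in `[1%R, 2%R]) c%:E)%E).
  rewrite integral_cst//= lebesgue_measure_itv/= lte_fin ltrDr ltr01.
  by rewrite -EFinB mule_gt0// lte_fin// subr_gt0 ltrDr.
apply: (@le_trans _ _ (\int[leb]_(t in `[1%R, 2%R]) (t `^ (s - 1) * expR (- t))%:E)%E).
  apply: ge0_le_integral => //.
  - by move=> x _; rewrite lee_fin ltW.
  - by apply/measurable_EFinP; exact: measurable_gamma_integrand.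
  - move=> x; rewrite /= in_itv/= => /andP[x1 x2]; rewrite lee_fin /c.
    apply: ler_pM; rewrite ?expR_ge0//; last by rewrite ler_expR lerN2.
    rewrite ge_min; have [s1|s1] := leP 1 s.
      by rewrite -[X in X <= _](congr1 (fun h => h (s - 1)) (@powR1 R)) ge0_ler_powR// ?nnegrE ?subr_ge0 ?(le_trans _ x1)// orbT.
    apply/orP; right; rewrite -[s - 1]opprK opprB !powRN.
    have x0 := lt_le_trans ltr01 x1.
    rewrite lef_pV2 ?posrE ?powR_gt0// ge0_ler_powR// ?nnegrE ?subr_ge0 ?(ltW s1)//.
    exact: ltW.
apply: ge0_subset_integral => //.
- by apply/measurable_EFinP; exact: measurable_gamma_integrand.
- by move=> x _; rewrite lee_fin.
- by move=> x; rewrite /= !in_itv/= andbT => /andP[/(lt_le_trans ltr01)].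
Qed.

Lemma riesz_cst_gt0 N (l : R) : 0 < l -> l < N%:R -> 0 < riesz_cst N l.
Proof.
move=> l0 lN; rewrite /riesz_cst divr_gt0// ?mulr_gt0 ?powR_gt0 ?pi_gt0//.
- by apply: Gamma_gt0; rewrite divr_gt0// subr_gt0.
- by apply: Gamma_gt0; rewrite divr_gt0.
Qed.

End gamma.

(** * Smooth functions built from exp(-1/t) *)

Section flat.
Context {R : realType}.

(** The powers of [t^-1] are those produced by differentiating [flat 0]; including them closes the
    family under derivatives, up to linear combinations. *)
Definition flat (k : nat) (t : R) : R :=
  if 0 < t then t^-1 ^+ k * expR (- t^-1) else 0.

Lemma flat_ge0 k t : 0 <= flat k t.
Proof.
rewrite /flat; case: ifP => // t0.
by rewrite mulr_ge0 ?expR_ge0// exprn_ge0// invr_ge0 ltW.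
Qed.

Lemma flat0_le1 t : flat 0 t <= 1.
Proof.
rewrite /flat; case: ifP => // t0.
by rewrite mul1r -expR0 ler_expR oppr_le0 invr_ge0 ltW.
Qed.

Lemma flat0_gt0 t : (0 < flat 0 t) = (0 < t).
Proof. by rewrite /flat; case: ifP; rewrite ?ltxx// mul1r expR_gt0. Qed.

(** A single term of the exponential series at [t^-1], the one of degree [k + 2], already beats
    [t^-1 ^+ k] by a factor [t ^+ 2]. This gives differentiability at 0. *)
Lemma flat_le k t : flat k t <= k.+2`!%:R * t ^+ 2.
Proof.
rewrite /flat; case: ifPn => [t0|_]; last by rewrite mulr_ge0 ?sqr_ge0.
rewrite expRN ler_pdivrMr ?expR_gt0// -mulrA -ler_pdivrMl ?ltr0n ?fact_gt0//.
rewrite -ler_pdivrMl ?exprn_gt0//.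
have s0 : 0 <= t^-1 by rewrite invr_ge0 ltW.
apply: (@le_trans _ _ (t^-1 ^+ k.+2 / k.+2`!%:R)); last first.
  by apply: le_trans (expR_ge1Dxn k.+1 s0); rewrite lerDr.
by rewrite -exprVn mulrCA -exprD mulrC add2n.
Qed.

Lemma is_derive_flat k (t : R) :
  is_derive t 1 (flat k) (flat k.+2 t - k%:R * flat k.+1 t).
Proof.
have [t0|t0|t0] := ltgtP 0 t.
- have tn0 : t != 0 by rewrite gt_eqF.
  have dV : is_derive t 1 (fun t : R => t^-1) (- t ^- 2).
    have := @is_deriveV _ (@id R) t 1 1 tn0 (is_derive_id t 1).
    by rewrite /GRing.scale/= mulr1.
  have dE : is_derive t 1 (fun t : R => expR (- t^-1)) (expR (- t^-1) * t ^- 2).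
    have -> : (fun t : R => expR (- t^-1)) = expR \o (fun t : R => - t^-1) by [].
    apply: is_derive1_comp; rewrite -[X in is_derive _ _ _ X]opprK.
    exact: is_deriveN.
  have dF : is_derive t 1 (fun t : R => t^-1 ^+ k * expR (- t^-1))
      (flat k.+2 t - k%:R * flat k.+1 t).
    have -> : (fun t : R => t^-1 ^+ k * expR (- t^-1)) =
        ((fun t : R => t^-1) ^+ k) * (fun t : R => expR (- t^-1)).
      by apply/funext => x; rewrite [RHS]/GRing.mul/= exprfctE.
    apply: is_derive_eq; rewrite exprfctE /GRing.scale/= /flat t0.
    case: k => [|k] /=.
      by rewrite !expr0 !mul0r !mulr0 ?mul0r ?subr0 ?addr0 mul1r exprVn mulrC.
    by rewrite -!exprVn !exprS; ring.
  apply: near_eq_is_derive dF.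
  by near=> x; rewrite /flat ifT//; near: x; exact: lt_nbhsr.
- rewrite /flat !ifF; [|by rewrite ltNge ltW|by rewrite ltNge ltW].
  rewrite mulr0 subr0; apply: near_eq_is_derive (is_derive_cst 0 t 1).
  near=> x; rewrite ifF//; apply/negbTE; rewrite -leNgt ltW//.
  by near: x; exact: lt_nbhsl.
(* At 0 the quadratic bound [flat_le] makes the difference quotient at most (k+2)! |h|, so the
   derivative exists and is 0. *)
- rewrite -{}t0 /flat !ltxx mulr0 subr0.
  have cv : (fun h : R => h^-1 *: ((flat k \o shift 0) (h *: 1) - flat k 0)) @ 0^' --> (0 : R).
    apply/cvgrPdist_le => e e0; near=> h.
    have h0 : h != 0 by near: h; exact: nbhs_dnbhs_neq.
    rewrite /= /GRing.scale/= mulr1 addr0 {2}/flat ltxx subr0 sub0r normrN.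
    rewrite normrM normfV ler_pdivrMl ?normr_gt0// (ger0_norm (flat_ge0 _ _)).
    apply: le_trans (flat_le k h) _.
    rewrite -(real_normK (num_real h)) expr2 mulrCA ler_pM2l ?normr_gt0//.
    rewrite mulrC -ler_pdivlMr ?ltr0n ?fact_gt0//; near: h; apply: dnbhs0_le.
    by rewrite divr_gt0// ltr0n fact_gt0.
  by apply: DeriveDef; [apply/cvg_ex; exists 0|apply: cvg_lim].
Unshelve. all: by end_near. Qed.

Lemma continuous_flat k : continuous (flat k).
Proof.
move=> t; apply/differentiable_continuous/derivable1_diffP.
by have [] := is_derive_flat k t.
Qed.

Lemma flat0_cvg1 (t : R) : 0 < t -> flat 0 (n%:R * t) @[n --> \oo] --> (1 : R).
Proof.
move=> t0.
suff : flat 0 (n%:R * t) @[n --> \oo] --> expR (- 0 : R) by rewrite oppr0 expR0.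
apply: (@cvg_trans _ ((fun n => expR (- (n%:R * t)^-1)) @ \oo)).
  apply: near_eq_cvg; near=> n.
  rewrite /flat mulr_gt0 ?mul1r// ltr0n.
  by near: n; exact: nbhs_infty_gt.
have h : - (n%:R * t)^-1 @[n --> \oo] --> (- 0 : R); last first.
  exact: (cvg_comp _ _ h (@continuous_expR R _)).
apply: cvgN; apply/cvgrPdist_le => e e0; near=> n.
have n0 : 0 < n%:R * t by rewrite mulr_gt0// ltr0n; near: n; exact: nbhs_infty_gt.
rewrite sub0r normrN ger0_norm ?invr_ge0 ?(ltW n0)// invf_ple ?posrE// -ler_pdivrMr//.
by near: n; exact: nbhs_infty_ger.
Unshelve. all: by end_near. Qed.

End flat.

Section flat_alg.
Context {R : realType} {N : nat}.
Local Notation rV := 'rV[R]_N.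

(* Stable under partial derivatives, hence made of smooth functions; products of
   generators give test functions supported in boxes, and the generators with
   large [a] approximate half-spaces. *)
Inductive flat_alg : (rV -> R) -> Prop :=
| flat_alg_cst c : flat_alg (fun=> c)
| flat_alg_gen k a b i : flat_alg (fun x => flat k (a * x ord0 i + b))
| flat_algD f g : flat_alg f -> flat_alg g -> flat_alg (fun x => f x + g x)
| flat_algM f g : flat_alg f -> flat_alg g -> flat_alg (fun x => f x * g x).

Lemma flat_alg_prod (I : Type) (r : seq I) (F : I -> rV -> R) :
  (forall i, flat_alg (F i)) -> flat_alg (fun x => \prod_(i <- r) F i x).
Proof.
move=> hF; elim: r => [|i r IH].
  by under eq_fun do rewrite big_nil; exact: flat_alg_cst.
by under eq_fun do rewrite big_cons; exact: flat_algM.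
Qed.

Lemma flat_alg_continuous f : flat_alg f -> continuous f.
Proof.
elim => [c|k a b i|{}f g _ cf _ cg|{}f g _ cf _ cg] x.
- exact: cst_continuous.
- apply: (@continuous_comp _ _ _ (fun x : rV => a * x ord0 i + b) (flat k)).
    apply: continuousD; last exact: cst_continuous.
    apply: continuousM; [exact: cst_continuous|exact: coord_continuous].
  exact: continuous_flat.
- by apply: continuousD; [exact: cf|exact: cg].
- by apply: continuousM; [exact: cf|exact: cg].
Qed.

Lemma is_derive_coord (g : R -> R) (dg : R) (i j : 'I_N) (x : rV) :
  is_derive (x ord0 j) 1 g dg ->
  is_derive x (delta_mx ord0 i) (fun x => g (x ord0 j)) ((i == j)%:R * dg).
Proof.
move=> dgx; have [->|ij] := eqVneq i j.
  have E : (fun h : R => h^-1 *: (((fun x : rV => g (x ord0 j)) \o shift x)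
        (h *: delta_mx ord0 j) - g (x ord0 j))) =
      (fun h : R => h^-1 *: ((g \o shift (x ord0 j)) (h *: 1) - g (x ord0 j))).
    by apply/funext => h; rewrite /= !mxE !eqxx.
  case: dgx => dg1 dg2; rewrite mul1r; apply: DeriveDef.
    by rewrite /derivable E.
  by rewrite /derive E.
have E : (fun h : R => h^-1 *: (((fun x : rV => g (x ord0 j)) \o shift x)
      (h *: delta_mx ord0 i) - g (x ord0 j))) = cst 0.
  apply/funext => h; rewrite /= !mxE eqxx eq_sym (negbTE ij) mulr0 add0r.
  by rewrite subrr scaler0.
rewrite mul0r; apply: DeriveDef.
  by rewrite /derivable E; exact: is_cvg_cst.
by rewrite /derive E lim_cst.
Qed.

Lemma flat_alg_derive f i : flat_alg f ->
  exists2 df, flat_alg df & forall x, is_derive x (delta_mx ord0 i) f (df x).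
Proof.
elim => [c|k a b j|{}f g af [df adf hf] ag [dg adg hg]|{}f g af [df adf hf] ag [dg adg hg]].
- exists (fun=> 0); first exact: flat_alg_cst.
  by move=> x; exact: is_derive_cst.
- exists (fun x => (i == j)%:R * ((flat k.+2 (a * x ord0 j + b) +
     (- k%:R) * flat k.+1 (a * x ord0 j + b)) * a)).
    apply: flat_algM; first exact: flat_alg_cst.
    apply: flat_algM; last exact: flat_alg_cst.
    apply: flat_algD; first exact: flat_alg_gen.
    by apply: flat_algM; [exact: flat_alg_cst|exact: flat_alg_gen].
  move=> x; apply: (@is_derive_coord (fun t => flat k (a * t + b))).
  have -> : (fun t => flat k (a * t + b)) = flat k \o (fun t => a * t + b) by [].
  apply: is_derive1_comp; first by rewrite mulNr; exact: is_derive_flat.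
  have -> : (fun t => a * t + b) = a *: id + cst b by [].
  by apply: is_derive_eq; rewrite addr0 /GRing.scale/= mulr1.
- by exists (fun x => df x + dg x); [exact: flat_algD|move=> x; exact: is_deriveD].
- exists (fun x => f x * dg x + g x * df x).
    by apply: flat_algD; apply: flat_algM.
  by move=> x; exact: is_deriveM.
Qed.

Lemma flat_alg_smooth f : flat_alg f -> smooth f.
Proof.
move=> af; have H s : flat_alg (iter_partial s f).
  elim: s => [//|i s IH] /=.
  have [df adf hdf] := flat_alg_derive i IH.
  by rewrite (_ : (fun _ => _) = df)//; apply/funext => x; exact: derive_val.
move=> s; split; first exact/flat_alg_continuous/H.
by move=> i x; have [df _ /(_ x) []] := flat_alg_derive i (H s).
Qed.

(** The arguments are [1 + m (x_i - c_i)] and [1 - m (x_i - c_i)], both positive exactly when [x_i]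
    is within [m^-1] of [c_i]. They are expanded to match the affine form of [flat_alg_gen]. *)
Definition box_bump (c : rV) (m : R) (x : rV) : R :=
  \prod_(i < N) (flat 0 (m * x ord0 i + (1 - m * c ord0 i)) *
                 flat 0 (- m * x ord0 i + (1 + m * c ord0 i))).

Lemma flat_alg_box_bump c m : flat_alg (box_bump c m).
Proof. by apply: flat_alg_prod => i; apply: flat_algM; exact: flat_alg_gen. Qed.

Lemma box_bump_ge0 c m x : 0 <= box_bump c m x.
Proof. by apply: prodr_ge0 => i _; rewrite mulr_ge0 ?flat_ge0. Qed.

Lemma box_bump_gt0 (c : rV) m (x : rV) : 0 < m ->
  (forall i, `|x ord0 i - c ord0 i| < m^-1) <-> 0 < box_bump c m x.
Proof.
move=> m0; have E i : (`|x ord0 i - c ord0 i| < m^-1) =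
    (0 < flat 0 (m * x ord0 i + (1 - m * c ord0 i)) *
                 flat 0 (- m * x ord0 i + (1 + m * c ord0 i))).
  rewrite ltr_norml -[m^-1]mul1r -mulNr ltr_pdivrMr// ltr_pdivlMr//.
  apply/andP/idP => [[h1 h2]|].
    by rewrite mulr_gt0// flat0_gt0; lra.
  rewrite lt_neqAle eq_sym mulf_eq0 negb_or => /andP[/andP[]].
  by rewrite !neq_lt !(ltNge _ 0) !flat_ge0/= !flat0_gt0 => h1 h2 _; split; lra.
split=> [h|h i]; first by apply: prodr_gt0 => i _; rewrite -E.
have : box_bump c m x != 0 by rewrite gt_eqF.
rewrite E lt_neqAle eq_sym mulr_ge0 ?flat_ge0// andbT; apply: contraNN.
by rewrite /box_bump (bigD1 i)//= => /eqP <-; rewrite mul0r.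
Qed.

Lemma test_function_box_bump c m g : 0 < m -> flat_alg g ->
  test_function (fun x => g x * box_bump c m x).
Proof.
move=> m0 ag; split.
  by apply: flat_alg_smooth; apply: flat_algM => //; exact: flat_alg_box_bump.
pose A (i : 'I_N) : set R := [set` `[c ord0 i - m^-1, c ord0 i + m^-1]].
have cA : compact [set x : rV | forall i, A i (x ord0 i)].
  by apply: rV_compact => i; exact: segment_compact.
apply: (subclosed_compact (@closed_closure _ _) cA).
have clA : closed [set x : rV | forall i, A i (x ord0 i)].
  by apply: compact_closed => //; exact: norm_hausdorff.
rewrite ((closure_id _).1 clA); apply: closure_subset => x /= gb i.
have : 0 < box_bump c m x.
  rewrite lt_neqAle box_bump_ge0 andbT eq_sym; apply: contraNN gb => /eqP ->.
  by rewrite mulr0.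
move/box_bump_gt0 => /(_ m0 i); rewrite ltr_distl => /andP[h1 h2].
by rewrite /A/= in_itv/= !ltW.
Qed.

End flat_alg.

(** * Completed measures and weighted L1 distances *)

Section borel_cover.
Context d (T : measurableType d) (R : realType).
Variable m : {sigma_finite_measure set T -> \bar R}.
Local Notation mu := (@completed_measure_extension _ _ _ m).

(** For finite measure, covers of total mass below [mu E + k.+1^-1] exist by definition of the outer
    measure, and the intersection of their unions over [k] exceeds [E] by a null set only. The lemma
    lets arguments about Borel sets reach Lebesgue measurable ones. *)
Lemma completed_measure_cover (A : set (caratheodory_type m^*%mu)) : measurable A ->
  exists B : set T, [/\ measurable B, A `<=` B & mu (B `\` A) = 0%E].
Proof.
have fin (E : set (caratheodory_type m^*%mu)) : measurable E -> (mu E < +oo)%E ->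
    exists B : set T, [/\ measurable B, E `<=` B & mu (B `\` E) = 0%E].
  move=> mE Eoo.
  have H (k : nat) : exists F : (set T)^nat, [/\ forall i, measurable (F i),
      E `<=` \bigcup_i F i &
      (\sum_(i <oo) m (F i) < mu E + k.+1%:R^-1%:E)%E].
    have fE : mu E \is a fin_num by rewrite ge0_fin_numE.
    have k0 : 0 < k.+1%:R^-1 :> R by rewrite invr_gt0.
    have [_/= [F [mF EF] <-] h] := lb_ereal_inf_adherent k0 fE.
    by exists F.
  have {H} [F HF] := choice H.
  pose U k := \bigcup_i F k i.
  have mU k : measurable (U k).
    by apply: bigcupT_measurable => i; have [] := HF k.
  exists (\bigcap_k U k); have mB : measurable (\bigcap_k U k) by exact: bigcapT_measurable.
  split => //; first by move=> x Ex k _; have [_ + _] := HF k; exact.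
  have mB' : measurable (\bigcap_k U k : set (caratheodory_type m^*%mu)) by exact: caratheodory_measurable_mu_ext.
  have EB : E `<=` \bigcap_k U k by move=> x Ex k _; have [_ + _] := HF k; exact.
  have BE : (mu (\bigcap_k U k) <= mu E)%E.
    apply/lee_addgt0Pr => e e0.
    have [k ke] : exists k : nat, k.+1%:R^-1 < e.
      exists (Num.truncn e^-1); rewrite invf_plt ?posrE//.
      exact: truncnS_gt.
    have [mF _ hk] := HF k.
    apply: (@le_trans _ _ (mu (U k))).
      by apply: le_outer_measure; exact: bigcap_inf.
    apply: (le_trans (outer_measure_sigma_subadditive m^*%mu (F k))).
    rewrite (_ : limn _ = \sum_(i <oo) m (F k i))%E; last first.
      by apply: eq_eseriesr => i _; exact: (measurable_mu_extE m).
    by apply: (le_trans (ltW hk)); rewrite leeD2l// lee_fin ltW.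
  have := @measureD _ _ _ mu _ _ mB' mE (le_lt_trans BE Eoo).
  rewrite setIidr// => ->.
  apply/eqP; rewrite eq_le sube_le0 BE/= sube_ge0.
    by apply: le_measure; rewrite ?inE.
  by rewrite ge0_fin_numE ?Eoo.
move=> mA.
(* Gluing: the finite case yields [B k] around each [A] cut by [G k]. A point of [B k] outside [A]
   lies in the excess of [B k], so the excess of the union is covered by countably many null
   sets. *)
have : sigma_finite setT (m : set T -> \bar R) by exact: sigma_finiteT.
move=> [G TG Gfin].
have mG k : measurable (G k : set (caratheodory_type m^*%mu)).
  by apply: caratheodory_measurable_mu_ext; have [] := Gfin k.
have H k : exists B : set T, [/\ measurable B, A `&` G k `<=` B & mu (B `\` (A `&` G k)) = 0%E].
  apply: fin; first exact: measurableI.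
  apply: (@le_lt_trans _ _ (mu (G k))).
    by apply: le_measure; rewrite ?inE//; exact: measurableI.
  have [mGk Gkoo] := Gfin k.
  by rewrite [mu _](measurable_mu_extE m mGk).
have {H} [B HB] := choice H.
exists (\bigcup_k B k); split.
- by apply: bigcupT_measurable => k; have [] := HB k.
- move=> x Ax; have : [set: T] x by []; rewrite TG => -[k _ Gkx].
  by exists k => //; have [_ + _] := HB k; apply.
have mBk k : measurable (B k : set (caratheodory_type m^*%mu)).
  by apply: caratheodory_measurable_mu_ext; have [] := HB k.
have : mu.-negligible (\bigcup_k (B k `\` (A `&` G k))).
  apply: negligible_bigcup => k; apply/negligibleP.
    by apply: measurableD => //; exact: measurableI.
  by have [] := HB k.
move=> h; have : mu.-negligible (\bigcup_k B k `\` A).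
  apply: negligibleS h => x [[k _ Bkx] nAx]; exists k => //; split => // -[].
  by move=> /nAx.
by move/negligibleP; apply; apply: measurableD => //; exact: bigcupT_measurable.
Qed.


End borel_cover.

Section weighted_distance.
Context d (T : measurableType d) (R : realType).
Variables (mu : {measure set T -> \bar R}) (w : T -> R).
Local Notation wdist f g := (\int[mu]_x (`|f x - g x| * `|w x|)%:E)%E.

Lemma measurable_wdist (f g : T -> R) : measurable_fun setT w ->
  measurable_fun setT f -> measurable_fun setT g ->
  measurable_fun setT (fun x => (`|f x - g x| * `|w x|)%:E).
Proof.
move=> mw mf mg; apply/measurable_EFinP; apply: measurable_funM.
  by apply: measurableT_comp => //; exact: measurable_funB.
exact: measurableT_comp.
Qed.

(** Stated with an arbitrary pointwise domination, it serves both as the triangle inequality and for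
    merging approximations of two sets into one of their union. *)
Lemma wdist_add (f1 f2 g1 g2 h k : T -> R) : measurable_fun setT w ->
  measurable_fun setT f1 -> measurable_fun setT f2 ->
  measurable_fun setT g1 -> measurable_fun setT g2 ->
  measurable_fun setT h -> measurable_fun setT k ->
  (forall x, `|h x - k x| <= `|f1 x - g1 x| + `|f2 x - g2 x|) ->
  (wdist h k <= wdist f1 g1 + wdist f2 g2)%E.
Proof.
move=> mw mf1 mf2 mg1 mg2 mh mk H; rewrite -ge0_integralD//; [|exact: measurable_wdist..].
apply: ge0_le_integral => //.
- exact: measurable_wdist.
- by apply: emeasurable_funD; exact: measurable_wdist.
- by move=> x _; rewrite -EFinD lee_fin -mulrDl ler_wpM2r.
Qed.

Hypothesis iw : mu.-integrable setT (fun x => (w x)%:E).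

Let mw : measurable_fun setT w.
Proof. by apply/measurable_EFinP; exact: measurable_int iw. Qed.

(** Dominated convergence: [|w|] is an integrable majorant because the differences are bounded by
    1. *)
Lemma wdist_dct (h : nat -> T -> R) (k : T -> R) (e : R) :
  (forall n, measurable_fun setT (h n)) -> measurable_fun setT k ->
  (forall n x, `|h n x - k x| <= 1) ->
  (forall x, h n x @[n --> \oo] --> k x) -> 0 < e ->
  exists n, (wdist (h n) k < e%:E)%E.
Proof.
move=> mh mk hk1 hk e0.
pose f_ n (x : T) : \bar R := (`|h n x - k x| * `|w x|)%:E.
have cvf x : f_ n x @[n --> \oo] --> 0%E.
  apply/fine_cvgP; split; first exact: nearW.
  rewrite -[X in _ --> X](mul0r `|w x|); apply: cvgMl.
  rewrite -[X in _ --> X](@normr0 R R); apply: cvg_norm.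
  rewrite -(subrr (k x)); apply: cvgB; [exact: hk|exact: cvg_cst].
have mf_ n : measurable_fun setT (f_ n) by exact: measurable_wdist.
have iaw : mu.-integrable setT (fun x => `|(w x)%:E|)%E by exact: integrable_abse.
have aef : {ae mu, forall x, setT x -> f_ ^~ x @ \oo --> (cst 0 x : \bar R)}.
  by apply: aeW => x _; exact: cvf.
have aew : {ae mu, forall x n, setT x -> (`|f_ n x| <= `|(w x)%:E|)%E}.
  apply: aeW => x n _; rewrite /f_ /= lee_fin ger0_norm ?mulr_ge0//.
  by rewrite ler_piMl.
have [_ _] := @dominated_convergence _ _ _ mu setT measurableT f_ (cst 0%E) _
  mf_ (measurable_cst _) aef iaw aew.
rewrite integral0 => /fine_cvgP[fin cv].
have /cvgrPdist_lt/(_ _ e0) H := cv.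
near \oo => n; exists n.
have fn : (\int[mu]_x f_ n x)%E \is a fin_num by near: n.
rewrite -[X in (X < _)%E](fineK fn) lte_fin.
apply: le_lt_trans (ler_norm _) _; rewrite -normrN -[- _]add0r.
by near: n.
Unshelve. all: by end_near. Qed.

Lemma integrable_bounded1M (h : T -> R) : measurable_fun setT h ->
  (forall x, `|h x| <= 1) -> mu.-integrable setT (fun x => (h x * w x)%:E).
Proof.
move=> mh h1; apply: (le_integrable _ _ _ iw) => //.
  by apply/measurable_EFinP; exact: measurable_funM.
by move=> x _; rewrite /= lee_fin normrM ler_piMl.
Qed.

(** Replacing [f] by [k] changes the integral against [w] by at most their weighted distance, so
    nonnegativity passes to the limit. *)
Lemma integral_ge0_approx (k : T -> R) :
  measurable_fun setT k -> (forall x, `|k x| <= 1) ->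
  (forall e : R, 0 < e -> exists f : T -> R, [/\ measurable_fun setT f,
     forall x, `|f x - k x| <= 1, (0 <= \int[mu]_x (f x * w x)%:E)%E &
     (wdist k f < e%:E)%E]) ->
  (0 <= \int[mu]_x (k x * w x)%:E)%E.
Proof.
move=> mk k1 H; apply/lee_addgt0Pr => e e0.
have [f [mf fk f0 fe]] := H _ e0.
have mfk : measurable_fun setT (fun x => f x - k x) by exact: measurable_funB.
apply: (le_trans f0).
have -> : (\int[mu]_x (f x * w x)%:E =
    \int[mu]_x (k x * w x)%:E + \int[mu]_x ((f x - k x) * w x)%:E)%E.
  rewrite -integralD//; [|exact: integrable_bounded1M..].
  by apply: eq_integral => x _; rewrite -EFinD; congr EFin; ring.
apply: leeD => //; apply: (le_trans (lee_abs _)).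
apply: (le_trans (le_abse_integral _ _ _)) => //.
  by apply/measurable_EFinP; exact: measurable_funM.
apply: le_trans (ltW fe).
by under eq_integral do rewrite /= normrM distrC.
Qed.

(** Since [B] and [A] differ by a null set, the integral of [w] over [A] is nonnegative although
    [w < 0] there; hence [w] times the indicator of [A] vanishes almost everywhere. The set [B] is
    present because nonnegativity will be known for Borel sets only. *)
Lemma integral_neg_part_ge0 (B : set T) (A := [set x | w x < 0]) :
  measurable B -> A `<=` B -> mu (B `\` A) = 0%E ->
  (0 <= \int[mu]_x (\1_B x * w x)%:E)%E -> {ae mu, forall x, 0 <= w x}.
Proof.
move=> mB AB BA0 B0.
have mA : measurable A.
  rewrite (_ : A = setT `&` w @^-1` `]-oo, 0[%classic); first exact: mw.
  by apply/seteqP; split => x; rewrite /A /= in_itv/= => // -[].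
have indic1 (C : set T) x : `|\1_C x| <= 1 :> R.
  by rewrite indicE; case: (_ \in _); rewrite ?normr1 ?normr0.
have mA1 C : measurable C -> measurable_fun setT (fun x => (\1_C x * w x)%:E).
  move=> mC.
  by apply/measurable_EFinP; apply: measurable_funM => //; exact: measurable_indic.
have AB0 : (\int[mu]_x (\1_A x * w x)%:E = \int[mu]_x (\1_B x * w x)%:E)%E.
  apply: ae_eq_integral => //; [exact: mA1|exact: mA1|].
  exists (B `\` A); split => //; first exact: measurableD.
  move=> x /= nE; apply: contrapT => nBA; apply: nE => _.
  congr (_ * _)%:E; rewrite !indicE; congr (_ %:R); congr nat_of_bool.
  have [Ax|nAx] := pselect (A x).
    by rewrite !mem_set//; exact: AB.
  by rewrite !memNset// => Bx; apply: nBA.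
have : (\int[mu]_x `|(\1_A x * w x)%:E| = 0)%E.
  have E x : `|(\1_A x * w x)%:E|%E = (- (\1_A x * w x)%:E)%E.
    rewrite /= indicE; congr EFin.
    have [Ax|nAx] := pselect (A x).
      by rewrite mem_set// mul1r ltr0_norm.
    by rewrite memNset// mul0r normr0 oppr0.
  apply/eqP; rewrite eq_le; apply/andP; split; last first.
    by apply: integral_ge0 => x _; exact: abse_ge0.
  under eq_integral do rewrite E.
  under eq_integral do rewrite -mulN1e.
  rewrite integralZl ?AB0 ?mulN1e ?oppe_le0//.
  exact: integrable_bounded1M (measurable_indic mA) (indic1 A).
move/(ae_eq_integral_abs mu measurableT (mA1 _ mA)); apply: filterS => x /(_ Logic.I) /=.
rewrite indicE; have [Ax|nAx _] := pselect (A x).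
  by rewrite mem_set// mul1r => -[->].
by rewrite leNgt; apply/negP.
Qed.

Lemma integrable_supportedM (f v : T -> R) (K : set T) (M : R) :
  measurable K -> measurable_fun setT f -> measurable_fun setT v ->
  (forall x, `|f x| <= M) -> (forall x, ~ K x -> f x = 0) -> 0 <= M ->
  (\int[mu]_(x in K) `|v x|%:E < +oo)%E ->
  mu.-integrable setT (fun x => (f x * v x)%:E).
Proof.
move=> mK mf mv fM fK M0 vK.
apply/integrableP; split; first by apply/measurable_EFinP; exact: measurable_funM.
apply: (@le_lt_trans _ _ (\int[mu]_(x in K) (M%:E * `|v x|%:E))%E).
  rewrite [leRHS]integral_mkcond; apply: ge0_le_integral.
  - exact: measurableT.
  - by move=> x _; exact: abse_ge0.
  - by apply: measurableT_comp => //; apply/measurable_EFinP; exact: measurable_funM.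
  - apply/(measurable_restrictT _ mK); apply: measurable_funTS.
    apply: measurable_funeM; apply/measurable_EFinP.
    exact: measurableT_comp.
  - move=> x _; rewrite patchE; case: ifPn => [_|xK].
      by rewrite -EFinM lee_fin normrM ler_wpM2r.
    by rewrite fK ?mul0r ?abse0// => Kx; rewrite mem_set in xK.
rewrite ge0_integralZl//; first by rewrite lte_mul_pinfty.
by apply/measurable_EFinP; apply: measurable_funTS; exact: measurableT_comp.
Qed.

End weighted_distance.

(** * Measurability on the space of row vectors *)

Section measurability.
Context {R : realType} {N : nat}.
Local Notation rV := 'rV[R]_N.
Local Notation rVL := (caratheodory_type (@product_lebesgue R N)^*%mu).
Local Notation mu := (@lebesgue_rV R N).

Lemma caratheodory_measurable_fun d (T : measurableType d) (f : rV -> T) :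
  measurable_fun [set: rV] f -> measurable_fun [set: rVL] f.
Proof.
move=> mf _ Y mY; rewrite setTI; apply: caratheodory_measurable_mu_ext.
by rewrite -[X in measurable X]setTI; exact: mf.
Qed.

Lemma measurable_flat_alg (f : rV -> R) : flat_alg f -> measurable_fun [set: rV] f.
Proof.
elim => [c|k a b i|{}f g _ mf _ mg|{}f g _ mf _ mg].
- exact: measurable_cst.
- apply: (measurableT_comp (continuous_measurable_fun (@continuous_flat R k))).
  apply: measurable_funD => //; apply: measurable_funM => //.
  exact: measurable_coord.
- exact: measurable_funD.
- exact: measurable_funM.
Qed.

Lemma rat_rV_approx (x : rV) (e : R) : 0 < e ->
  exists c : 'rV[rat]_N, forall i, `|x ord0 i - ratr (c ord0 i)| < e.
Proof.
move=> e0; have H i : {q : rat | `|x ord0 i - ratr q| < e}.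
  apply: cid; have /rat_in_itvoo[q] : x ord0 i - e < x ord0 i + e.
    by rewrite ltrD2l gtrN.
  rewrite in_itv/= => /andP[h1 h2]; exists q.
  by rewrite distrC ltr_distl h1 h2.
by exists (\row_i sval (H i)) => i; rewrite mxE; exact: (svalP (H i)).
Qed.

(** The sigma-algebra is generated by the coordinates, not by the topology, so an open set has to be
    exhibited as a countable union of boxes, here with rational centres and radii [m.+1^-1]. *)
Lemma open_rV_measurable (A : set rV) : open A -> measurable A.
Proof.
move=> oA.
pose box (c : 'rV[rat]_N) (m : nat) : set rV :=
  [set x | forall i, [set` `]ratr (c ord0 i) - m.+1%:R^-1, ratr (c ord0 i) + m.+1%:R^-1[] (x ord0 i)].
have mbox c m : measurable (box c m).
  by have [] := @product_lebesgue_box R N (fun i : 'I_N =>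
    [set` `]ratr (c ord0 i) - m.+1%:R^-1, ratr (c ord0 i) + m.+1%:R^-1[])
    (fun i => measurable_itv _).
(* An enumeration of the boxes contained in [A]; codes of other boxes, and integers that code
   nothing, contribute the empty set. *)
pose F (k : nat) : set rV :=
  if unpickle k is Some (c, m) then
    if asbool (box c m `<=` A) then box c m else set0 else set0.
have -> : A = \bigcup_k F k.
  apply/seteqP; split => x; last first.
    move=> [k _]; rewrite /F; case: unpickle => // -[c m].
    by case: ifPn => // /asboolP; exact.
  move=> Ax; have /nbhs_ballP[e /= e0 xeA] := open_nbhs_nbhs (conj oA Ax).
  (* With radius below [e / 2], a box that contains [x] lies in the ball of radius [e] around
     [x]. *)
  have [m me] : exists m : nat, m.+1%:R^-1 < e / 2.
    exists (Num.truncn (e / 2)^-1); rewrite invf_plt ?posrE ?divr_gt0//.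
    exact: truncnS_gt.
  have m0 : 0 < m.+1%:R^-1 :> R by rewrite invr_gt0.
  have [c Hc] := rat_rV_approx x m0.
  exists (pickle (c, m)) => //; rewrite /F pickleK ifT.
    by move=> i /=; rewrite in_itv/= -ltr_distl.
  apply/asboolP => y by_; apply: xeA; split => // j i; rewrite [j]ord1.
  have := by_ i; rewrite /= in_itv/= -ltr_distl => yi.
  rewrite /ball/= -(subrK (ratr (c ord0 i)) (x ord0 i)) -addrA.
  apply: le_lt_trans (ler_normD _ _) _; rewrite [ltRHS]splitr ltrD//.
    exact: lt_trans (Hc i) me.
  by rewrite distrC; exact: lt_trans yi me.
apply: bigcupT_measurable => k; rewrite /F; case: unpickle => // -[c m].
by case: ifP.
Qed.

Lemma continuous_rV_measurable (f : rV -> R) :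
  continuous f -> measurable_fun [set: rV] f.
Proof.
move=> cf; apply: (measurability _ (RGenOInfty.measurableE R)) => //.
move=> _ [_ [a ->] <-]; rewrite setTI; apply: open_rV_measurable.
by move/continuousP: cf; apply; exact: interval_open.
Qed.

Lemma measurable_enorm_sub d (T : measurableType d) (D : set T) (f g : T -> rV) :
  (forall i, measurable_fun D (fun t => f t ord0 i)) ->
  (forall i, measurable_fun D (fun t => g t ord0 i)) ->
  measurable_fun D (fun t => enorm (f t - g t)).
Proof.
move=> mf mg; rewrite /enorm.
apply: (measurableT_comp (f := @Num.sqrt R)).
  exact: (continuous_measurable_fun (@sqrt_continuous R)).
apply: measurable_sum => i; apply: measurable_funX.
under eq_fun do rewrite !mxE.
exact: measurable_funB.
Qed.

Lemma measurable_coord_car (i : 'I_N) :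
  measurable_fun [set: rVL] (fun x : rV => x ord0 i).
Proof. by apply: caratheodory_measurable_fun; exact: measurable_coord. Qed.

Lemma compact_rV_measurable (K : set rV) :
  compact K -> measurable (K : set rVL).
Proof.
move=> cK; apply: caratheodory_measurable_mu_ext.
rewrite -[K]setCK; apply: measurableC; apply: open_rV_measurable.
by apply: closed_openC; apply: compact_closed => //; exact: norm_hausdorff.
Qed.

(** One factor of the product measure is that of a single real point. In dimension 0 there is no
    factor, and the measure is a unit mass at the only point. *)
Lemma lebesgue_rV_set1 (x : rV) : (0 < N)%N -> mu [set x] = 0%E.
Proof.
move=> N0; have -> : [set x] = [set y : rV | forall i, [set x ord0 i] (y ord0 i)].
  apply/seteqP; split => y /=; first by move=> -> i.
  by move=> h; apply/rowP => i; exact: h.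
apply: (eq_trans (@lebesgue_rV_box R N (fun i => [set x ord0 i]) _)).
  by move=> i; exact: measurable_set1.
rewrite (bigD1 (Ordinal N0))//=.
by rewrite [X in (X * _)%E](lebesgue_measure_set1 (x ord0 (Ordinal N0))) mul0e.
Qed.

Lemma compact_rV_fin (K : set rV) : compact K -> (mu K < +oo)%E.
Proof.
move=> cK; have [M [_ HM]] := compact_bounded cK.
have {}HM := HM (M + 1) (ltr_pwDr ltr01 (lexx _)).
pose B : set rV := [set x | forall i, [set` `[- (M + 1), M + 1]] (x ord0 i)].
have mB : measurable (B : set rVL).
  apply: caratheodory_measurable_mu_ext.
  by have [] := @product_lebesgue_box R N (fun i : 'I_N =>
    [set` `[- (M + 1), M + 1]]) (fun i => measurable_itv _).
have KB : K `<=` B.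
  move=> x Kx i; rewrite /= in_itv/= -ler_norml.
  apply: le_trans (HM x Kx); rewrite [leRHS]/Num.norm/= mx_normrE.
  exact: (le_bigmax _ (fun ij => `|x ij.1 ij.2|) (ord0, i)).
apply: (@le_lt_trans _ _ (mu B)).
  by apply: le_measure; rewrite ?inE//; exact: compact_rV_measurable.
rewrite [X in (X < _)%E](@lebesgue_rV_box R N (fun=> [set` `[- (M + 1), M + 1]]) _); last first.
  by move=> i; exact: measurable_itv.
set I := [set` _]; suff [] : ((0 <= \prod_(i < N) lebesgue_measure I) /\
  (\prod_(i < N) lebesgue_measure I < +oo))%E by [].
apply: (big_ind (fun y : \bar R => 0 <= y /\ y < +oo)%E).
- by rewrite lee01 ltry.
- by move=> y z [y0 yoo] [z0 zoo]; rewrite mule_ge0// lte_mul_pinfty// ge0_fin_numE.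
- by move=> i _; split; [exact: measure_ge0|rewrite /I lebesgue_measure_itv/=; case: ifP; rewrite ltry].
Qed.

(** With the constant 1, statements on products of a test function and a weight also cover the test
    function alone; this is the origin of the integrands [f y * 1] below. *)
Lemma locally_integrable_cst (c : R) : locally_integrable_rV (fun _ : rV => c).
Proof.
split; first exact: measurable_cst.
move=> K cK; rewrite integral_cst; last exact: compact_rV_measurable.
by rewrite lte_mul_pinfty ?compact_rV_fin.
Qed.

Lemma test_function_bounded (f : rV -> R) : test_function f ->
  exists2 M, 0 <= M & forall x, `|f x| <= M.
Proof.
move=> [sf cK]; have [cf _] := sf [::].
set K := closure _ in cK.
have : compact (f @` K) by apply: continuous_compact => //; exact: continuous_subspaceT.
move=> /compact_bounded[M [_ HM]].
have {}HM := HM (`|M| + 1) (le_lt_trans (ler_norm M) (ltr_pwDr ltr01 (lexx _))).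
exists (`|M| + 1); first by rewrite addr_ge0.
move=> x; have [->|fx0] := eqVneq (f x) 0; first by rewrite normr0 addr_ge0.
by apply: HM; exists x => //; exact: subset_closure.
Qed.

Lemma test_function_measurable (f : rV -> R) : test_function f ->
  measurable_fun [set: rVL] f.
Proof.
move=> [sf _]; have [cf _] := sf [::].
by apply: caratheodory_measurable_fun; exact: continuous_rV_measurable.
Qed.

Lemma test_function_integrableM (f w : rV -> R) : test_function f ->
  locally_integrable_rV w -> mu.-integrable setT (fun x => (f x * w x)%:E).
Proof.
move=> tf [mw iw]; have [M M0 HM] := test_function_bounded tf.
have [_ cK] := tf; have mK := compact_rV_measurable cK.
apply: (integrable_supportedM mK (test_function_measurable tf) mw HM _ M0 (iw _ cK)).
move=> x nx; apply/eqP; apply: contrapT => /negP fx0; apply: nx.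
exact: subset_closure.
Qed.

End measurability.

(** * Density of smooth functions *)

Section density.
Context {R : realType} {N : nat}.
Local Notation rV := 'rV[R]_N.
Local Notation rVL := (caratheodory_type (@product_lebesgue R N)^*%mu).
Local Notation mu := (@lebesgue_rV R N).

Variable w : rV -> R.
Hypothesis iw : mu.-integrable setT (fun x => (w x)%:E).

Let mw : measurable_fun [set: rVL] w.
Proof. by apply/measurable_EFinP; exact: measurable_int iw. Qed.

Let wdist (f g : rV -> R) : \bar R := (\int[mu]_x (`|f x - g x| * `|w x|)%:E)%E.

(** The range [0,1] is stable under [1 - f] and [1 - (1 - f) (1 - g)], and it keeps the distance to
    an indicator at most 1, as passing to limits requires. *)
Let good (f : rV -> R) := flat_alg f /\ forall x, 0 <= f x <= 1.

(* These sets form a sigma-algebra containing the half-spaces, hence all Borel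
   sets. *)
Let approx (A : set rV) := measurable A /\
  forall e : R, 0 < e -> exists2 f, good f & (wdist (\1_A) f < e%:E)%E.

Let good_measurable f : good f -> measurable_fun [set: rVL] f.
Proof.
by case=> af _; apply: caratheodory_measurable_fun; exact: measurable_flat_alg.
Qed.

Let indic_measurable (A : set rV) : measurable A -> measurable_fun [set: rVL] (\1_A : rV -> R).
Proof.
by move=> mA; apply: caratheodory_measurable_fun; exact: measurable_indic.
Qed.

Let approx_setC A : approx A -> approx (~` A).
Proof.
move=> [mA hA]; split; first exact: measurableC.
move=> e /hA[f [af f01] fe]; exists (fun x => 1 + - 1 * f x).
  split.
    apply: flat_algD; first exact: flat_alg_cst.
    by apply: flat_algM => //; exact: flat_alg_cst.
  by move=> x; have := f01 x; lra.
rewrite (_ : wdist _ _ = wdist \1_A f)//; apply: eq_integral => x _.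
congr (_ * _)%:E; rewrite -normrN; congr `|_|.
by rewrite !indicE in_setC; case: (x \in A) => /=; ring.
Qed.

Let approx_set0 : approx set0.
Proof.
split=> // e e0; exists (fun=> 0).
  by split=> [|x]; [exact: flat_alg_cst|rewrite lexx ler01].
rewrite /wdist (eq_integral (cst 0%E)) ?integral0// => x _.
by rewrite indic0 subr0 normr0 mul0r.
Qed.

(** The approximant is [1 - (1 - f) (1 - g)]. For factors in [0,1] its error is pointwise at most
    the sum of the two errors. *)
Let approx_setU A B : approx A -> approx B -> approx (A `|` B).
Proof.
move=> [mA hA] [mB hB]; split; first exact: measurableU.
move=> e e0; have e20 : 0 < e / 2 by rewrite divr_gt0.
have [f [af f01] fe] := hA _ e20; have [g [ag g01] ge] := hB _ e20.
have gh : good (fun x => 1 + - 1 * ((1 + -1 * f x) * (1 + -1 * g x))).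
  split.
    apply: flat_algD; first exact: flat_alg_cst.
    apply: flat_algM; first exact: flat_alg_cst.
    apply: flat_algM; (apply: flat_algD; first exact: flat_alg_cst);
      by apply: flat_algM => //; exact: flat_alg_cst.
  by move=> x; have := f01 x; have := g01 x; nra.
exists (fun x => 1 + - 1 * ((1 + -1 * f x) * (1 + -1 * g x))) => //.
apply: (@le_lt_trans _ _ (wdist \1_A f + wdist \1_B g)%E); last first.
  by rewrite (splitr e) EFinD lteD.
apply: wdist_add; [exact: mw|exact: indic_measurable|exact: indic_measurable|
  exact: good_measurable|exact: good_measurable|
  by apply: indic_measurable; exact: measurableU|exact: good_measurable|].
move=> x; have := f01 x; have := g01 x; rewrite !indicE in_setU.
case: (x \in A); case: (x \in B) => /= /andP[g0 g1] /andP[f0 f1].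
- rewrite [X in _ <= X + _]ger0_norm ?[X in _ <= _ + X]ger0_norm ?subr_ge0//.
  by rewrite ler_norml; apply/andP; split; nra.
- rewrite [X in _ <= X + _]ger0_norm ?subr_ge0// sub0r normrN (ger0_norm g0).
  by rewrite ler_norml; apply/andP; split; nra.
- rewrite [X in _ <= _ + X]ger0_norm ?subr_ge0// sub0r normrN (ger0_norm f0).
  by rewrite ler_norml; apply/andP; split; nra.
- rewrite !sub0r !normrN (ger0_norm f0) (ger0_norm g0).
  by rewrite ler_norml; apply/andP; split; nra.
Qed.

Let indic_dist (A B : set rV) x : `|\1_A x - \1_B x| <= 1 :> R.
Proof.
by rewrite !indicE; case: (_ \in _); case: (_ \in _);
  rewrite ?subrr ?subr0 ?sub0r ?normrN ?normr0 ?normr1.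
Qed.

Let approx_bigcup (F : (set rV)^nat) : (forall n, approx (F n)) ->
  approx (\bigcup_n F n).
Proof.
move=> aF; have mU : measurable (\bigcup_n F n).
  by apply: bigcupT_measurable => n; have [] := aF n.
split=> // e e0; have e20 : 0 < e / 2 by rewrite divr_gt0.
(* Finite unions converge pointwise to the full union, so some [G n] is within [e / 2] of it; the
   other half is spent on approximating that [G n]. *)
pose G n := \big[setU/set0]_(i < n) F i.
have aG n : approx (G n).
  by apply: (big_ind approx) => //; exact: approx_setU.
have [n Gn] : exists n, (wdist (\1_(G n)) \1_(\bigcup_n F n) < (e / 2)%:E)%E.
  apply: (wdist_dct iw _ _ _ _ e20).
  - by move=> n; apply: indic_measurable; have [] := aG n.
  - exact: indic_measurable.
  - by move=> n x; exact: indic_dist.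
  - move=> x; have [[k _ Fkx]|nFx] := pselect ((\bigcup_n F n) x).
      apply: (@cvg_trans _ (cst 1 @ \oo)); last first.
        by rewrite indicE mem_set; [exact: cvg_cst|exists k].
      apply: near_eq_cvg; near=> n; rewrite indicE mem_set//.
      rewrite /G -bigcup_mkord; exists k => //=.
      by near: n; exact: nbhs_infty_gt.
    rewrite indicE memNset//.
    apply: (@cvg_trans _ (cst 0 @ \oo)); last exact: cvg_cst.
    apply: near_eq_cvg; apply: nearW => n; rewrite indicE memNset//.
    by rewrite /G -bigcup_mkord => -[k _ Fkx]; apply: nFx; exists k.
have [mG /(_ _ e20)[f gf fe]] := aG n; exists f => //.
apply: (@le_lt_trans _ _ (wdist \1_(G n) f + wdist \1_(G n) \1_(\bigcup_n F n))%E); last first.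
  by rewrite (splitr e) EFinD lteD.
apply: wdist_add; [exact: mw|exact: indic_measurable|exact: indic_measurable|
  exact: good_measurable|exact: indic_measurable|
  exact: indic_measurable|exact: good_measurable|].
move=> x; rewrite [in leRHS]addrC [X in _ <= X + _]distrC.
exact: ler_distD.
Unshelve. all: by end_near. Qed.

Let approx_halfspace (i : 'I_N) (a : R) :
  approx ((fun x : rV => x ord0 i) @^-1` `]a, +oo[%classic).
Proof.
have mA : measurable ((fun x : rV => x ord0 i) @^-1` `]a, +oo[%classic).
  by rewrite -[X in measurable X]setTI; apply: measurable_coord.
split=> // e e0.
(* The argument is [n (x_i - a)]: the value tends to 1 where [x_i > a] and is exactly 0 elsewhere,
   including on the boundary. *)
pose h (n : nat) (x : rV) := flat 0 (n%:R * x ord0 i + - (n%:R * a)) : R.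
have gh n : good (h n).
  by split=> [|x]; [exact: flat_alg_gen|rewrite flat_ge0 flat0_le1].
have [n hn] : exists n, (wdist (h n)
    \1_((fun x : rV => x ord0 i) @^-1` `]a, +oo[%classic) < e%:E)%E.
  apply: (wdist_dct iw _ _ _ _ e0).
  - by move=> n; exact: good_measurable.
  - exact: indic_measurable.
  - move=> n x; have [_ /(_ x)/andP[h0 h1]] := gh n.
    rewrite indicE; case: (_ \in _).
      by rewrite distrC ger0_norm ?subr_ge0// gerBl.
    by rewrite subr0 ger0_norm.
  - move=> x; rewrite /h; under eq_fun do rewrite -mulrN -mulrDr.
    have [ax|xa] := ltP a (x ord0 i).
      rewrite indicE mem_set/=; last by rewrite in_itv/= ax.
      by apply: flat0_cvg1; rewrite subr_gt0.
    rewrite indicE memNset/=; last by rewrite in_itv/= andbT; apply/negP; rewrite -leNgt.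
    apply: (@cvg_trans _ (cst 0 @ \oo)); last exact: cvg_cst.
    apply: near_eq_cvg; apply: nearW => n; rewrite /flat ifF//.
    by apply/negbTE; rewrite -leNgt mulr_ge0_le0// subr_le0.
exists (h n) => //; rewrite /wdist.
by under eq_integral do rewrite distrC.
Qed.

Let approx_measurable (A : set rV) : measurable A -> approx A.
Proof.
move: A; apply: smallest_sub.
  split; first exact: approx_set0.
    by move=> A aA; rewrite setTD; exact: approx_setC.
  exact: approx_bigcup.
rewrite -bigcup_seq => A [i _ [B mB <-]] /=; rewrite setTI.
(* A second induction on generation: preimages of Borel subsets of the line are reduced to preimages
   of open half-lines. *)
have : <<s @RGenOInfty.G R >> B.
  have E := congr1 (fun S : set (set R) => S B) (RGenOInfty.measurableE R).
  exact: (eq_ind _ (fun P : Prop => P) mB _ E).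
move: B {mB}; apply: smallest_sub.
  split; first by rewrite /= preimage_set0; exact: approx_set0.
    by move=> B /= aB; rewrite setTD preimage_setC; exact: approx_setC.
  by move=> F /= aF; rewrite preimage_bigcup; exact: approx_bigcup.
by move=> B /= [a ->]; exact: approx_halfspace.
Qed.

(** Indicators of Borel sets are limits of such [f], so [w] has nonnegative integral over a Borel
    hull of the set where it is negative. The functions [f] are not compactly supported;
    integrability of [w] makes up for it. *)
Lemma ae_ge0_flat_alg :
  (forall f, flat_alg f -> (forall x, 0 <= f x <= 1) ->
     (0 <= \int[mu]_x (f x * w x)%:E)%E) ->
  {ae mu, forall x, 0 <= w x}.
Proof.
move=> H.
have mA : measurable ([set x | w x < 0] : set rVL).
  rewrite (_ : mkset _ = setT `&` w @^-1` `]-oo, 0[%classic); first exact: mw.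
  by apply/seteqP; split => x; rewrite /= in_itv/= => // -[].
have [B [mB AB BA0]] := completed_measure_cover mA.
apply: (integral_neg_part_ge0 iw _ AB BA0).
  exact: caratheodory_measurable_mu_ext.
apply: (integral_ge0_approx iw (indic_measurable mB)).
  by move=> x; rewrite indicE; case: (_ \in _); rewrite ?normr1 ?normr0.
have [_ hB] := approx_measurable mB.
move=> e /hB[f gf fe]; have [af f01] := gf; exists f; split => //.
- exact: good_measurable.
- move=> x; have /andP[f0 f1] := f01 x; rewrite indicE; case: (_ \in _).
    by rewrite distrC ger0_norm ?subr_ge0// gerBl.
  by rewrite subr0 ger0_norm.
- exact: H.
Qed.

End density.

(** * Minkowski's integral inequality *)

Section generic.
Context d (T : measurableType d) (R : realType).

Lemma fatou_le (m : {measure set T -> \bar R}) (f : (T -> \bar R)^nat)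
    (g : T -> \bar R) (c : \bar R) :
  (forall n, measurable_fun setT (f n)) -> (forall n x, 0 <= f n x)%E ->
  (forall x, f n x @[n --> \oo] --> g x) ->
  (forall n, \int[m]_x f n x <= c)%E -> (\int[m]_x g x <= c)%E.
Proof.
move=> mf f0 fg fc.
have -> : (\int[m]_x g x = \int[m]_x limn_einf (f^~ x))%E.
  by apply: eq_integral => x _; rewrite (cvg_limn_einf_sup (fg x)).1.
apply: (le_trans (fatou m measurableT mf (fun n x _ => f0 n x))).
rewrite limn_einf_lim; apply: lime_le; first exact: is_cvg_einfs.
apply: nearW => n; apply: le_trans (fc n); apply: ereal_inf_lbound.
by exists n => /=.
Qed.

End generic.

(** [g] may change sign and its sections need not be integrable, so Tonelli is applied to the
    positive and negative parts. *)
Lemma measurable_integral_param d1 d2 (X : measurableType d1)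
    (Y : measurableType d2) (R : realType)
    (m : {sigma_finite_measure set Y -> \bar R}) (g : X * Y -> R) :
  measurable_fun setT g ->
  measurable_fun setT (fun x => \int[m]_y (g (x, y))%:E)%E.
Proof.
move=> mg; under eq_fun do rewrite integralE.
have mg' : measurable_fun setT (EFin \o g) by exact/measurable_EFinP.
apply: emeasurable_funB.
  rewrite (_ : (fun x => _) = fubini_F m (EFin \o g)^\+%E).
    by apply: measurable_fun_fubini_tonelli_F => //; exact: measurable_funepos.
  by apply/funext => x; apply: eq_integral => y _; rewrite !funeposE.
rewrite (_ : (fun x => _) = fubini_F m (EFin \o g)^\-%E).
  by apply: measurable_fun_fubini_tonelli_F => //; exact: measurable_funeneg.
by apply/funext => x; apply: eq_integral => y _; rewrite !funenegE.
Qed.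

Section minkowski.
Context d1 d2 (X : measurableType d1) (Y : measurableType d2) (R : realType).
Variables (mX : {sigma_finite_measure set X -> \bar R})
  (mY : {sigma_finite_measure set Y -> \bar R}).
Variables (k : X * Y -> R) (u : X -> R) (f w : Y -> R) (q c : R).
Hypotheses (q1 : 1 < q) (c0 : 0 <= c).
Hypotheses (mk : measurable_fun setT k) (k0 : forall z, 0 <= k z).
Hypotheses (meas_u : measurable_fun setT u) (u0 : forall x, 0 <= u x).
Hypotheses (mf : measurable_fun setT f) (f0 : forall y, 0 <= f y).
Hypotheses (mw : measurable_fun setT w) (w0 : forall y, 0 < w y).

Let q0 : 0 < q. Proof. exact: lt_trans q1. Qed.

Let measurable_section x : measurable_fun setT (fun y => k (x, y)).
Proof. by apply: measurableT_comp => //; exact: measurable_pair1. Qed.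

Let measurable_ksection y : measurable_fun setT (fun x => k (x, y)).
Proof. by apply: measurableT_comp => //; exact: measurable_pair2. Qed.

Let mpow (d : measure_display) (T : measurableType d) (g : T -> R) r :
  measurable_fun setT g -> measurable_fun setT (fun t => g t `^ r).
Proof. by move=> mg; exact: (measurableT_comp (measurable_powR r)). Qed.

Let jensen x (m : R) : (\int[mY]_y (f y * w y)%:E = m%:E)%E ->
  ((\int[mY]_y (f y * k (x, y))%:E) `^ q <=
   (m `^ (q - 1))%:E * \int[mY]_y (f y * w y `^ (1 - q) * k (x, y) `^ q)%:E)%E.
Proof.
move=> mE.
pose p := q / (q - 1).
have qm1 : 0 < q - 1 by rewrite subr_gt0.
have p0 : 0 < p by rewrite divr_gt0.
have pq : p^-1 + q^-1 = 1 by rewrite /p; field; rewrite !gt_eqF.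
(* The factors satisfy [a ^ p = f w] and [b ^ q = f w ^ (1 - q) k ^ q]. In [a b] the exponents of
   [f] add up to [1/p + 1/q = 1], and those of [w] to [1/p + (1 - q)/q = 0]. *)
pose a y := (f y * w y) `^ p^-1.
pose b y := (f y * w y `^ (1 - q)) `^ q^-1 * k (x, y).
have ab y : a y * b y = f y * k (x, y).
  rewrite /a /b mulrA -[X in _ = X * _]powRr1//; congr (_ * _).
  have [->|fy0] := eqVneq (f y) 0.
    by rewrite !mul0r !powR0 ?invr_neq0 ?gt_eqF// mul0r.
  rewrite !powRM ?powR_ge0 ?(ltW (w0 y))// mulrACA -!powRrM -!powRD ?fy0 ?implybT//;
    last by rewrite (gt_eqF (w0 y)) implybT.
  rewrite pq [X in _ * _ `^ X](_ : _ = 0) ?powRr0 ?mulr1//.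
  by rewrite /p; field; rewrite !gt_eqF.
have ma : measurable_fun setT a by apply: mpow; exact: measurable_funM.
have mb : measurable_fun setT b.
  apply: measurable_funM => //; apply: mpow; apply: measurable_funM => //.
  exact: mpow.
have := @hoelder _ _ _ mY a b p q ma mb p0 q0 pq.
rewrite Lnorm1 unlock /=.
under eq_integral => y _ do rewrite ab ger0_norm ?mulr_ge0//.
under [X in (_ <= X `^ _ * _)%E -> _]eq_integral => y _ do
  rewrite ger0_norm ?powR_ge0// -powRrM mulVf ?gt_eqF// powRr1 ?mulr_ge0 ?(ltW (w0 y))//.
under [X in (_ <= _ * X `^ _)%E -> _]eq_integral => y _ do
  rewrite ger0_norm ?mulr_ge0 ?powR_ge0// powRM ?powR_ge0// -powRrM mulVf ?gt_eqF// powRr1 ?mulr_ge0 ?powR_ge0//.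
rewrite mE => h.
have I0 : (0 <= \int[mY]_y (f y * k (x, y))%:E)%E.
  by apply: integral_ge0 => y _; rewrite lee_fin mulr_ge0.
have J0 : (0 <= \int[mY]_y (f y * w y `^ (1 - q) * k (x, y) `^ q)%:E)%E.
  by apply: integral_ge0 => y _; rewrite lee_fin !mulr_ge0 ?powR_ge0.
have H0 : (0 <= m%:E `^ p^-1 *
    (\int[mY]_y (f y * w y `^ (1 - q) * k (x, y) `^ q)%:E) `^ q^-1)%E.
  by rewrite mule_ge0 ?poweR_ge0.
have := @gt0_ler_poweR _ q (ltW q0) _ _ _ _ h.
rewrite !in_itv/= !leey !andbT I0 H0 => /(_ isT isT).
rewrite poweRM ?lee_fin ?powR_ge0 ?poweR_ge0// poweR_EFin -powRrM -poweRrM.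
rewrite mulVf ?gt_eqF// poweRe1//.
by rewrite (_ : p^-1 * q = q - 1)// /p; field; rewrite !gt_eqF.
Qed.

Lemma minkowski_integral_le :
  {ae mY, forall y, (\int[mX]_x (k (x, y) `^ q * u x)%:E <= ((c * w y) `^ q)%:E)%E} ->
  (\int[mY]_y (f y * w y)%:E < +oo)%E ->
  (\int[mX]_x ((\int[mY]_y (f y * k (x, y))%:E) `^ q * (u x)%:E) <=
    (c%:E * \int[mY]_y (f y * w y)%:E) `^ q)%E.
Proof.
move=> H Moo.
have M0 : (0 <= \int[mY]_y (f y * w y)%:E)%E.
  by apply: integral_ge0 => y _; rewrite lee_fin mulr_ge0// ltW.
have [m mE] : exists m : R, (\int[mY]_y (f y * w y)%:E = m%:E)%E.
  by exists (fine (\int[mY]_y (f y * w y)%:E)%E); rewrite fineK// ge0_fin_numE.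
have m0 : 0 <= m by rewrite -lee_fin -mE.
pose g y := f y * w y `^ (1 - q).
have mg : measurable_fun setT g by apply: measurable_funM => //; exact: mpow.
have g0 y : 0 <= g y by rewrite mulr_ge0 ?powR_ge0.
pose F (z : X * Y) : \bar R := (g z.2 * k z `^ q * u z.1)%:E.
have mF : measurable_fun setT F.
  apply/measurable_EFinP; apply: measurable_funM; last first.
    by apply: (measurableT_comp meas_u); exact: measurable_fst.
  apply: measurable_funM; last exact: mpow.
  by apply: (measurableT_comp mg); exact: measurable_snd.
have F0 z : (0 <= F z)%E by rewrite lee_fin !mulr_ge0 ?powR_ge0.
have mI : measurable_fun setT (fun x => \int[mY]_y (f y * k (x, y))%:E)%E.
  apply: (@measurable_fun_fubini_tonelli_F _ _ _ _ _ mY (fun z => (f z.2 * k z)%:E)).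
    apply/measurable_EFinP; apply: measurable_funM => //.
    by apply: (measurableT_comp mf); exact: measurable_snd.
  by move=> z; rewrite lee_fin mulr_ge0.
have mJ : measurable_fun setT (fun x => \int[mY]_y F (x, y))%E.
  exact: measurable_fun_fubini_tonelli_F.
apply: (@le_trans _ _ (\int[mX]_x ((m `^ (q - 1))%:E * \int[mY]_y F (x, y)))%E).
  apply: ge0_le_integral => //.
  - by move=> x _; rewrite mule_ge0 ?poweR_ge0// lee_fin.
  - apply: emeasurable_funM; last exact/measurable_EFinP.
    exact: (measurableT_comp (measurable_poweR q)).
  - exact: measurable_funeM.
  - move=> x _; rewrite /F/=.
    have -> : (\int[mY]_y (g y * k (x, y) `^ q * u x)%:E =
        (u x)%:E * \int[mY]_y (g y * k (x, y) `^ q)%:E)%E.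
      rewrite -ge0_integralZl ?lee_fin//.
      * by apply: eq_integral => y _; rewrite -EFinM mulrC.
      * by apply/measurable_EFinP; apply: measurable_funM => //; exact: mpow.
      * by move=> y _; rewrite lee_fin mulr_ge0 ?powR_ge0.
    rewrite muleCA muleC; apply: lee_wpmul2l; first by rewrite lee_fin.
    exact: jensen.
rewrite ge0_integralZl//; last 2 first.
- by move=> x _; exact: integral_ge0.
- by rewrite lee_fin powR_ge0.
rewrite -fubini_tonelli1// fubini_tonelli2//.
(* After the exchange of integrals, the hypothesis bounds the inner one by [(c w) ^ q], and
   [w ^ (1 - q) w ^ q = w] restores the weight. What remains is
   [m ^ (q - 1) c ^ q m = (c m) ^ q]. *)
apply: (@le_trans _ _ ((m `^ (q - 1))%:E * \int[mY]_y ((c `^ q)%:E * (f y * w y)%:E))%E).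
  apply: lee_wpmul2l; first by rewrite lee_fin powR_ge0.
  apply: ae_ge0_le_integral => //.
  - by move=> y _; exact: integral_ge0.
  - exact: measurable_fun_fubini_tonelli_G.
  - by move=> y _; rewrite -EFinM lee_fin !mulr_ge0 ?powR_ge0// ltW.
  - by apply: measurable_funeM; apply/measurable_EFinP; exact: measurable_funM.
  - apply: filterS H => y Hy _; rewrite /F /fubini_G/=.
    under eq_integral do rewrite -mulrA EFinM.
    rewrite ge0_integralZl//; last 3 first.
    + by apply/measurable_EFinP; apply: measurable_funM => //; exact: mpow.
    + by move=> x _; rewrite lee_fin mulr_ge0 ?powR_ge0.
    + by rewrite lee_fin.
    apply: (@le_trans _ _ ((g y)%:E * ((c * w y) `^ q)%:E)%E).
      by apply: lee_wpmul2l => //; rewrite lee_fin.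
    rewrite -!EFinM lee_fin powRM ?(ltW (w0 y))// /g mulrCA ler_wpM2l ?powR_ge0//.
    rewrite -mulrA -powRD ?(gt_eqF (w0 y)) ?implybT// subrK powRr1 ?(ltW (w0 y))//.
rewrite ge0_integralZl//; last 3 first.
- by apply/measurable_EFinP; exact: measurable_funM.
- by move=> y _; rewrite lee_fin mulr_ge0// ltW.
- by rewrite lee_fin powR_ge0.
rewrite mE -!EFinM poweR_EFin lee_fin powRM// mulrCA ler_wpM2l ?powR_ge0//.
by rewrite -(mulr_powRB1 m0 q0) mulrC.
Qed.

End minkowski.

(** * Weights that may vanish and signed densities *)

Section potential.
Context d1 d2 (X : measurableType d1) (Y : measurableType d2) (R : realType).
Variables (mX : {sigma_finite_measure set X -> \bar R})
  (mY : {sigma_finite_measure set Y -> \bar R}).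
Variables (k : X * Y -> R) (u : X -> R) (v : Y -> R) (q c : R).
Hypotheses (q1 : 1 < q) (c0 : 0 <= c).
Hypotheses (mk : measurable_fun setT k) (k0 : forall z, 0 <= k z).
Hypotheses (meas_u : measurable_fun setT u) (u0 : forall x, 0 <= u x).
Hypotheses (mv : measurable_fun setT v) (v0 : forall y, 0 <= v y).
Hypothesis kuv : {ae mY, forall y,
  (\int[mX]_x (k (x, y) `^ q * u x)%:E <= ((c * v y) `^ q)%:E)%E}.

Let q0 : 0 < q. Proof. exact: lt_trans q1. Qed.

Let integral_fM_ge0 (f g : Y -> R) : (forall y, 0 <= f y) -> (forall y, 0 <= g y) ->
  (0 <= \int[mY]_y (f y * g y)%:E)%E.
Proof. by move=> f0 g0; apply: integral_ge0 => y _; rewrite lee_fin mulr_ge0. Qed.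

Let measurable_fM (f g : Y -> R) : measurable_fun setT f -> measurable_fun setT g ->
  measurable_fun setT (fun y => (f y * g y)%:E).
Proof. by move=> mf mg; apply/measurable_EFinP; exact: measurable_funM. Qed.

Let mpot (f : Y -> R) : measurable_fun setT f ->
  measurable_fun setT (fun x => \int[mY]_y (f y * k (x, y))%:E)%E.
Proof.
move=> mf.
apply: (@measurable_integral_param _ _ _ _ _ mY (fun z => f z.2 * k z)).
apply: measurable_funM => //; apply: (measurableT_comp mf).
exact: measurable_snd.
Qed.

(* Replacing [v] by [v + e] makes the weight positive, as the proof by Hoelder
   requires. *)
Lemma minkowski_integral (f : Y -> R) : measurable_fun setT f ->
  (forall y, 0 <= f y) -> (\int[mY]_y (f y * 1)%:E < +oo)%E ->
  (\int[mY]_y (f y * v y)%:E < +oo)%E ->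
  ((\int[mX]_x ((\int[mY]_y (f y * k (x, y))%:E) `^ q * (u x)%:E)) `^ q^-1 <=
    c%:E * \int[mY]_y (f y * v y)%:E)%E.
Proof.
move=> mf f0 foo fvoo.
have [F FE] : exists F : R, (\int[mY]_y (f y * 1)%:E = F%:E)%E.
  by exists (fine (\int[mY]_y (f y * 1)%:E)%E); rewrite fineK// ge0_fin_numE// integral_fM_ge0.
have F0 : 0 <= F by rewrite -lee_fin -FE integral_fM_ge0.
have split_e (e : R) : 0 < e -> (\int[mY]_y (f y * (v y + e))%:E =
    \int[mY]_y (f y * v y)%:E + (e * F)%:E)%E.
  move=> e0; rewrite EFinM -FE -ge0_integralZl ?lee_fin ?(ltW e0)//; last 2 first.
  - by apply: measurable_fM.
  - by move=> y _; rewrite lee_fin mulr_ge0.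
  rewrite -ge0_integralD//.
  - by apply: eq_integral => y _; rewrite -EFinM -EFinD; congr EFin; ring.
  - by move=> y _; rewrite lee_fin mulr_ge0.
  - exact: measurable_fM.
  - by move=> y _; rewrite -EFinM lee_fin !mulr_ge0// ltW.
  - by apply: measurable_funeM; exact: measurable_fM.
apply/lee_addgt0Pr => e e0.
(* Adding [de] to [v] raises the right-hand side by [c * de * F], which this choice keeps below [e];
   the added ones avoid division by zero. *)
have d0 : 0 < e / ((c + 1) * (F + 1)) by rewrite divr_gt0// mulr_gt0// ltr_wpDl.
set de := e / _ in d0 *.
pose w y := v y + de.
have w0 y : 0 < w y by rewrite ltr_wpDl.
have woo : (\int[mY]_y (f y * w y)%:E < +oo)%E.
  by rewrite split_e// lte_add_pinfty// ltry.
have mw : measurable_fun setT w by exact: measurable_funD.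
have Hw : {ae mY, forall y, (\int[mX]_x (k (x, y) `^ q * u x)%:E <= ((c * w y) `^ q)%:E)%E}.
  apply: filterS kuv => y /le_trans; apply; rewrite lee_fin.
  apply: ge0_ler_powR; rewrite ?nnegrE ?(ltW q0) ?mulr_ge0 ?(ltW (w0 _))//.
  by rewrite ler_wpM2l// lerDl ltW.
have := minkowski_integral_le q1 c0 mk k0 meas_u u0 mf f0 mw w0 Hw woo.
set L := (\int[mX]_x _)%E => h.
have L0 : (0 <= L)%E.
  by apply: integral_ge0 => x _; rewrite mule_ge0 ?poweR_ge0// lee_fin.
have qi0 : 0 <= q^-1 by rewrite invr_ge0 ltW.
have := @gt0_ler_poweR _ q^-1 qi0 _ _ _ _ h.
rewrite !in_itv/= !leey !andbT L0 poweR_ge0 => /(_ isT isT) => h3.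
apply: (le_trans h3); rewrite -poweRrM mulfV ?gt_eqF// poweRe1; last first.
  by rewrite mule_ge0 ?lee_fin// integral_fM_ge0// => y; rewrite ltW.
rewrite split_e// ge0_muleDr ?integral_fM_ge0//; last first.
  by rewrite lee_fin mulr_ge0// ltW.
apply: leeD => //; rewrite -EFinM lee_fin /de.
rewrite [leLHS](_ : _ = e * ((c / (c + 1)) * (F / (F + 1)))); last first.
  by field; rewrite !gt_eqF// ltr_wpDl.
rewrite ler_piMr ?(ltW e0)// mulr_ile1 ?divr_ge0 ?addr_ge0//.
  by rewrite ler_pdivrMr ?ltr_wpDl// mul1r lerDl.
by rewrite ler_pdivrMr ?ltr_wpDl// mul1r lerDl.
Qed.

(** Reduction to [|f|]: the absolute value is taken inside the inner integral, and [g ^ q] is pulled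
    out of the outer one before the root is taken. *)
Lemma potential_weighted_bound (g : R) (f : Y -> R) : 0 <= g ->
  measurable_fun setT f ->
  (\int[mY]_y (`|f y| * 1)%:E < +oo)%E -> (\int[mY]_y (`|f y| * v y)%:E < +oo)%E ->
  ((\int[mX]_x (`|g%:E * \int[mY]_y (f y * k (x, y))%:E| `^ q * (u x)%:E)) `^ q^-1 <=
    (g * c)%:E * \int[mY]_y (`|f y| * v y)%:E)%E.
Proof.
move=> g0 mf foo fvoo.
have maf : measurable_fun setT (fun y => `|f y|) by exact: measurableT_comp.
have := minkowski_integral maf (fun=> normr_ge0 _) foo fvoo.
set J := (\int[mX]_x _)%E => h.
have I0 x : (0 <= \int[mY]_y (`|f y| * k (x, y))%:E)%E by exact: integral_fM_ge0.
have mI : measurable_fun setT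
    (fun x => (\int[mY]_y (`|f y| * k (x, y))%:E) `^ q * (u x)%:E)%E.
  apply: emeasurable_funM; last exact/measurable_EFinP.
  by apply: (measurableT_comp (measurable_poweR q)); exact: mpot.
have J0 : (0 <= J)%E.
  by apply: integral_ge0 => x _; rewrite mule_ge0 ?poweR_ge0// lee_fin.
set L := (\int[mX]_x _)%E.
have L0 : (0 <= L)%E.
  by apply: integral_ge0 => x _; rewrite mule_ge0 ?poweR_ge0// lee_fin.
have LJ : (L <= (g `^ q)%:E * J)%E.
  rewrite -ge0_integralZl ?lee_fin ?powR_ge0//; last first.
    by move=> x _; rewrite mule_ge0 ?poweR_ge0// lee_fin.
  apply: ge0_le_integral => //.
  - by move=> x _; rewrite mule_ge0 ?poweR_ge0// lee_fin.
  - apply: emeasurable_funM; last exact/measurable_EFinP.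
    apply: (measurableT_comp (measurable_poweR q)).
    apply: measurableT_comp => //; apply: measurable_funeM; exact: mpot.
  - exact: measurable_funeM.
  - move=> x _; rewrite muleA; apply: lee_wpmul2r; first by rewrite lee_fin.
    rewrite -poweR_EFin -poweRM ?lee_fin//.
    apply: gt0_ler_poweR; rewrite ?(ltW q0)// ?in_itv/= ?leey ?andbT ?abse_ge0//.
      by rewrite mule_ge0// lee_fin.
    rewrite abseM gee0_abs ?lee_fin//.
    apply: lee_wpmul2l; first by rewrite lee_fin.
    apply: (le_trans (le_abse_integral _ _ _)) => //.
      apply: measurable_fM => //.
      by apply: (measurableT_comp mk); exact: measurable_pair1.
    by under eq_integral do rewrite /= normrM (ger0_norm (k0 (x, _))).
have qi0 : 0 <= q^-1 by rewrite invr_ge0 ltW.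
have gJ0 : (0 <= (g `^ q)%:E * J)%E by rewrite mule_ge0// lee_fin powR_ge0.
have := @gt0_ler_poweR _ q^-1 qi0 _ _ _ _ LJ.
rewrite !in_itv/= !leey !andbT L0 gJ0 => /(_ isT isT) => h3.
apply: (le_trans h3); rewrite poweRM ?lee_fin ?powR_ge0// poweR_EFin -powRrM.
rewrite mulfV ?gt_eqF// powRr1// EFinM -muleA.
by apply: lee_wpmul2l => //; rewrite lee_fin.
Qed.

End potential.

(** * Sufficiency *)

Lemma powR_invM (R : realType) (x p q : R) : (x `^ p)^-1 `^ q = (x `^ (p * q))^-1.
Proof. by rewrite -!powRN -powRrM mulNr. Qed.

(** * Coordinatewise comparison of Euclidean norms *)

Section enorm.
Context {R : realType} {N : nat}.
Local Notation rV := 'rV[R]_N.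

(* The norm of [padded e z] bounds the norm on the sup-norm ball of radius [e]
   around [z]. *)
Definition padded (e : R) (z : rV) : rV := \row_i (`|z ord0 i| + e).

Lemma enorm_ge0 (z : rV) : 0 <= enorm z. Proof. exact: sqrtr_ge0. Qed.

Lemma enorm0 : enorm (0 : rV) = 0.
Proof.
by rewrite /enorm big1 ?sqrtr0// => i _; rewrite mxE expr0n.
Qed.

Lemma enorm_gt0 (z : rV) (i : 'I_N) : z ord0 i != 0 -> 0 < enorm z.
Proof.
move=> zi; rewrite sqrtr_gt0; apply: (@lt_le_trans _ _ (z ord0 i ^+ 2)).
  by rewrite exprn_even_gt0.
by rewrite (bigD1 i)//= lerDl sumr_ge0// => j _; exact: sqr_ge0.
Qed.

Lemma ler_enorm (y z : rV) : (forall i, `|y ord0 i| <= `|z ord0 i|) ->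
  enorm y <= enorm z.
Proof.
move=> H; apply: ler_wsqrtr; apply: ler_sum => i _.
rewrite -(real_normK (num_real (y ord0 i))) -(real_normK (num_real (z ord0 i))).
by rewrite lerXn2r ?nnegrE.
Qed.

Let ler_norm_add (a b e : R) : `|a - b| <= e -> `|a| <= `|b| + e.
Proof. by move=> h; rewrite -lerBlDl (le_trans _ h)// lerB_dist. Qed.

Lemma padded_ge (e : R) (y z : rV) : (forall i, `|y ord0 i - z ord0 i| <= e) ->
  enorm y <= enorm (padded e z).
Proof.
move=> H; apply: ler_enorm => i; rewrite mxE; apply: le_trans (ler_norm _).
exact: ler_norm_add.
Qed.

Lemma padded_gt0 (e : R) (z : rV) : (0 < N)%N -> 0 < e -> 0 < enorm (padded e z).
Proof.
move=> N0 e0; apply: (@enorm_gt0 _ (Ordinal N0)).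
by rewrite mxE gt_eqF// ltr_wpDl.
Qed.

(** Used to replace the rational centre of a cube by the point of interest, at the cost of doubling
    the padding. *)
Lemma padded_shift (e : R) (y z : rV) : (forall i, `|y ord0 i - z ord0 i| <= e) ->
  enorm (padded e y) <= enorm (padded (e + e) z).
Proof.
move=> H; apply: ler_enorm => i; rewrite !mxE.
have e0 : 0 <= e by apply: le_trans (H i).
rewrite [leLHS]ger0_norm ?addr_ge0// [leRHS]ger0_norm ?addr_ge0// addrA lerD2r.
exact: ler_norm_add.
Qed.

Lemma padded_cvg (e : nat -> R) (z : rV) : e n @[n --> \oo] --> 0 ->
  enorm (padded (e n) z) @[n --> \oo] --> enorm z.
Proof.
move=> e0; rewrite /enorm.
have H : \sum_i (padded (e n) z) ord0 i ^+ 2 @[n --> \oo] --> \sum_i z ord0 i ^+ 2.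
  have -> : (\sum_i z ord0 i ^+ 2) = \sum_(i < N) `|z ord0 i| ^+ 2.
    by apply: eq_bigr => i _; rewrite real_normK// num_real.
  under eq_fun do under eq_bigr do rewrite mxE.
  apply: cvg_big => [|i _]; [exact: add_continuous|rewrite expr2].
  have h : `|z ord0 i| + e n @[n --> \oo] --> `|z ord0 i|.
    by rewrite -[X in _ --> X]addr0; apply: cvgD => //; exact: cvg_cst.
  by apply: cvgM.
exact: (cvg_comp _ _ H (@sqrt_continuous R _)).
Qed.

Lemma measurable_enorm_padded d (T : measurableType d) (D : set T) (f : T -> rV) (e : R) :
  (forall i, measurable_fun D (fun t => f t ord0 i)) ->
  measurable_fun D (fun t => enorm (padded e (f t))).
Proof.
move=> mf; rewrite (_ : (fun t => _) = (fun t => enorm (padded e (f t) - 0))); last first.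
  by apply/funext => t; rewrite subr0.
apply: measurable_enorm_sub => i; last exact: measurable_cst.
under eq_fun do rewrite mxE.
by apply: measurable_funD => //; exact: measurableT_comp.
Qed.

End enorm.

Section sufficiency.
Context {R : realType} {N : nat}.
Local Notation rV := 'rV[R]_N.
Local Notation rVL := (caratheodory_type (@product_lebesgue R N)^*%mu).
Local Notation mu := (@lebesgue_rV R N).

Lemma kernel_measurable (p : R) :
  measurable_fun [set: rVL * rVL] (fun z => (enorm (z.1 - z.2) `^ p)^-1).
Proof.
have h i : measurable_fun [set: rVL] (fun x : rV => x ord0 i) := measurable_coord_car i.
rewrite (_ : (fun z => _) = (fun z : rVL * rVL => enorm (z.1 - z.2) `^ (- p))).
  apply: (measurableT_comp (measurable_powR (- p))).
  apply: measurable_enorm_sub => i.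
    by apply: (measurableT_comp (h i)); exact: measurable_fst.
  by apply: (measurableT_comp (h i)); exact: measurable_snd.
by apply/funext => z; rewrite powRN.
Qed.

Lemma riesz_weighted_bound (l q C : R) (u v : rV -> R) (f : rV -> R) :
  0 < l -> l < N%:R -> 1 < q -> (forall x, 0 <= u x) -> (forall x, 0 <= v x) ->
  locally_integrable_rV u -> locally_integrable_rV v -> 0 < C ->
  {ae mu, forall y,
      ((\int[mu]_x (u x / enorm (x - y) `^ ((N%:R - l) * q))%:E) `^ q^-1
        <= C%:E * (v y)%:E)%E} ->
  test_function f ->
  ((\int[mu]_x (`|riesz l f x| `^ q * (u x)%:E)) `^ q^-1
        <= (riesz_cst N l * C)%:E * \int[mu]_x (`|f x| * v x)%:E)%E.
Proof.
move=> l0 lN q1 u0 v0 [mu_ _] vloc C0 H tf.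
have q0 : 0 < q by exact: lt_trans q1.
have [mv _] := vloc.
pose k (z : rV * rV) : R := (enorm (z.1 - z.2) `^ (N%:R - l))^-1.
have k0 z : 0 <= k z by rewrite invr_ge0 powR_ge0.
have int_abs (w : rV -> R) : locally_integrable_rV w -> (forall y, 0 <= w y) ->
    (\int[mu]_y (`|f y| * w y)%:E < +oo)%E.
  move=> lw w0; have /integrableP[_] := test_function_integrableM tf lw.
  by under eq_integral do rewrite /= normrM (ger0_norm (w0 _)).
(* The condition is raised to the power [q], and the exponent [(N - l) * q] is recognised as that of
   [k ^ q]. *)
have Hk : {ae mu, forall y, (\int[mu]_x (k (x, y) `^ q * u x)%:E <= ((C * v y) `^ q)%:E)%E}.
  apply: (@filterS _ _ (ae_filter_ringOfSetsType mu)) H => y Hy.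
  have := @gt0_ler_poweR _ q (ltW q0) _ _ _ _ Hy.
  rewrite !in_itv/= !leey !andbT poweR_ge0 mule_ge0 ?lee_fin ?(ltW C0)// => /(_ isT isT).
  rewrite -poweRrM mulVf ?gt_eqF// poweRe1; last first.
    by apply: integral_ge0 => x _; rewrite lee_fin mulr_ge0 ?invr_ge0 ?powR_ge0.
  by under [in X in _ -> X]eq_integral do rewrite /k/= powR_invM mulrC.
exact: (@potential_weighted_bound _ _ rVL rVL R mu mu k u v q C q1 (ltW C0)
  (kernel_measurable _) k0 mu_ u0 mv v0 Hk (riesz_cst N l) f
  (ltW (riesz_cst_gt0 l0 lN)) (test_function_measurable tf)
  (int_abs _ (locally_integrable_cst 1) (fun=> ler01)) (int_abs _ vloc v0)).
Qed.

End sufficiency.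

(** * Necessity *)

Section generic.
Context d (T : measurableType d) (R : realType).
Variable m : {measure set T -> \bar R}.

Lemma integral_affine (f v : T -> R) (C b : R) :
  m.-integrable setT (fun x => (f x * v x)%:E) ->
  m.-integrable setT (fun x => (f x * 1)%:E) ->
  m.-integrable setT (fun x => (f x * (C * v x - b))%:E) /\
  (\int[m]_x (f x * (C * v x - b))%:E =
    C%:E * \int[m]_x (f x * v x)%:E - b%:E * \int[m]_x (f x * 1)%:E)%E.
Proof.
move=> iv i1.
have E : (fun x => (f x * (C * v x - b))%:E) =
    (fun x => C%:E * (f x * v x)%:E - b%:E * (f x * 1)%:E)%E.
  by apply/funext => x; rewrite -!EFinM -EFinB; congr EFin; ring.
have iCv := integrableZl measurableT C iv; have ib := integrableZl measurableT b i1.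
rewrite E; split; first exact: integrableB.
by rewrite integralB// !integralZl.
Qed.

Lemma integralM_ge_cst (f g : T -> R) (a : R) : 0 <= a ->
  measurable_fun setT f -> (forall x, 0 <= f x) ->
  measurable_fun setT g -> (forall x, 0 <= g x) ->
  {ae m, forall x, f x * a <= f x * g x} ->
  (a%:E * \int[m]_x (f x * 1)%:E <= \int[m]_x (f x * g x)%:E)%E.
Proof.
move=> a0 mf f0 mg g0 H; rewrite -ge0_integralZl ?lee_fin//; last 2 first.
- by apply/measurable_EFinP; apply: measurable_funM.
- by move=> x _; rewrite lee_fin mulr_ge0.
apply: ae_ge0_le_integral => //.
- by move=> x _; rewrite -EFinM lee_fin !mulr_ge0.
- by apply: measurable_funeM; apply/measurable_EFinP; apply: measurable_funM.
- by move=> x _; rewrite lee_fin mulr_ge0.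
- by apply/measurable_EFinP; apply: measurable_funM.
- by apply: filterS H => x Hx _; rewrite -EFinM lee_fin mulr1 mulrC.
Qed.

Lemma weighted_norm_ge (h : T -> \bar R) (k u : T -> R) (q s : R) :
  0 < q -> 0 <= s -> measurable_fun setT h ->
  measurable_fun setT k -> (forall x, 0 <= k x) ->
  measurable_fun setT u -> (forall x, 0 <= u x) ->
  (forall x, (s * k x)%:E <= h x)%E ->
  (s%:E * (\int[m]_x (k x `^ q * u x)%:E) `^ q^-1 <=
    (\int[m]_x (`|h x| `^ q * (u x)%:E)) `^ q^-1)%E.
Proof.
move=> q0 s0 mh mk k0 mu u0 H.
have mkq : measurable_fun setT (fun x => (k x `^ q * u x)%:E).
  apply/measurable_EFinP; apply: measurable_funM => //.
  exact: (measurableT_comp (measurable_powR q)).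
have I0 : (0 <= \int[m]_x (k x `^ q * u x)%:E)%E.
  by apply: integral_ge0 => x _; rewrite lee_fin mulr_ge0 ?powR_ge0.
have -> : s%:E = ((s `^ q)%:E `^ q^-1)%E.
  by rewrite poweR_EFin -powRrM mulfV ?gt_eqF// powRr1.
rewrite -poweRM ?lee_fin ?powR_ge0//.
apply: gt0_ler_poweR; rewrite ?invr_ge0 ?(ltW q0)// ?in_itv/= ?leey ?andbT.
- by rewrite mule_ge0// lee_fin powR_ge0.
- by apply: integral_ge0 => x _; rewrite mule_ge0 ?poweR_ge0// lee_fin.
rewrite -ge0_integralZl ?lee_fin ?powR_ge0//; last first.
  by move=> x _; rewrite lee_fin mulr_ge0 ?powR_ge0.
apply: ge0_le_integral => //.
- by move=> x _; rewrite -EFinM lee_fin !mulr_ge0 ?powR_ge0.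
- exact: measurable_funeM.
- apply: emeasurable_funM; last exact/measurable_EFinP.
  apply: (measurableT_comp (measurable_poweR q)).
  exact: measurableT_comp.
- move=> x _; rewrite EFinM muleA; apply: lee_wpmul2r; first by rewrite lee_fin.
  rewrite -EFinM -powRM// -poweR_EFin.
  have sk0 : (0 <= (s * k x)%:E)%E by rewrite lee_fin mulr_ge0.
  have hx0 : (0 <= h x)%E by apply: le_trans (H x).
  by apply: gt0_ler_poweR; rewrite ?(ltW q0)// ?in_itv/= ?leey ?andbT ?abse_ge0// gee0_abs.
Qed.

End generic.

(** Undoes the truncation of a possibly infinite [K]: the value [+oo] is excluded because its
    truncations are all the naturals, and these would be bounded by [a / g]. *)
Lemma min_nat_le (R : realType) (K : \bar R) (g a : R) : 0 < g -> (0 <= K)%E ->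
  (forall n : nat, g * fine (Order.min K n%:R%:E) <= a) -> (K <= (a / g)%:E)%E.
Proof.
move=> g0; case: K => [r r0 H|_ H|//].
  have rn : r <= (Num.truncn r).+1%:R by rewrite ltW// truncnS_gt.
  have := H (Num.truncn r).+1; rewrite min_l ?lee_fin//= => h.
  by rewrite ler_pdivlMr// mulrC.
have := H (Num.truncn (a / g)).+1; rewrite min_r ?leey//=.
rewrite leNgt -ltr_pdivrMl// mulrC.
by rewrite truncnS_gt.
Qed.

Section necessity.
Context {R : realType} {N : nat}.
Local Notation rV := 'rV[R]_N.
Local Notation rVL := (caratheodory_type (@product_lebesgue R N)^*%mu).
Local Notation mu := (@lebesgue_rV R N).

Variables (l q C : R) (u v : rV -> R).
Hypotheses (N0 : (0 < N)%N) (l0 : 0 < l) (lN : l < N%:R) (q1 : 1 < q).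
Hypotheses (u0 : forall x, 0 <= u x) (v0 : forall x, 0 <= v x).
Hypotheses (uloc : locally_integrable_rV u) (vloc : locally_integrable_rV v).
Hypothesis C0 : 0 < C.
Hypothesis H : forall f : rV -> R, test_function f ->
  ((\int[mu]_x (`|riesz l f x| `^ q * (u x)%:E)) `^ q^-1
        <= C%:E * \int[mu]_x (`|f x| * v x)%:E)%E.

Let p := N%:R - l.
Let ga := riesz_cst N l.
Let p0 : 0 < p. Proof. by rewrite subr_gt0. Qed.
Let q0 : 0 < q. Proof. exact: lt_trans q1. Qed.
Let ga0 : 0 < ga. Proof. exact: riesz_cst_gt0. Qed.

(** The kernel evaluated at the corner farthest from [x] of the cube of half-side [e] around [c],
    that is, the infimum of the overview in closed form, which makes its measurability in [x]
    evident. *)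
Let kap (c : rV) (e : R) (x : rV) : R := (enorm (padded e (x - c)) `^ p)^-1.

Let kap_ge0 c e x : 0 <= kap c e x.
Proof. by rewrite invr_ge0 powR_ge0. Qed.

Let measurable_sub (c : rV) (i : 'I_N) :
  measurable_fun [set: rVL] (fun x : rV => (x - c) ord0 i).
Proof.
under eq_fun do rewrite !mxE.
by apply: measurable_funB; [exact: measurable_coord_car|exact: measurable_cst].
Qed.

Let measurable_kap (c : rV) (e r : R) :
  measurable_fun [set: rVL] (fun x : rV => (enorm (padded e (x - c)) `^ r)^-1).
Proof.
under eq_fun do rewrite -powRN.
apply: (measurableT_comp (measurable_powR (- r))).
by apply: measurable_enorm_padded => i; exact: measurable_sub.
Qed.

Let measurable_ker (x : rV) (r : R) :
  measurable_fun [set: rVL] (fun y : rV => (enorm (x - y) `^ r)^-1).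
Proof.
under eq_fun do rewrite -powRN.
apply: (measurableT_comp (measurable_powR (- r))).
apply: measurable_enorm_sub => i; first exact: measurable_cst.
exact: measurable_coord_car.
Qed.

Let K (c : rV) (e : R) : \bar R := ((\int[mu]_x (kap c e x `^ q * u x)%:E) `^ q^-1)%E.

Let riesz_ge (f : rV -> R) (c : rV) (e F : R) : 0 < e -> test_function f ->
  (forall y, 0 <= f y) ->
  (forall y, f y != 0 -> forall i, `|y ord0 i - c ord0 i| < e) ->
  (\int[mu]_y (f y * 1)%:E = F%:E)%E ->
  forall x, ((ga * F * kap c e x)%:E <= riesz l f x)%E.
Proof.
move=> e0 tf f0 fc FE x; rewrite /riesz -/ga -mulrA EFinM.
apply: lee_wpmul2l; first by rewrite lee_fin ltW.
rewrite mulrC EFinM -FE.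
apply: (integralM_ge_cst (kap_ge0 c e x) (test_function_measurable tf) f0 (measurable_ker x p)).
  by move=> y; rewrite invr_ge0 powR_ge0.
(* At [y = x] the kernel is 0 by convention, below the positive [kap]; this one point is
   discarded. *)
exists [set x]; split.
- by apply: compact_rV_measurable; exact: compact_set1.
- exact: lebesgue_rV_set1.
move=> y /= nle; apply: contrapT => yx; apply: nle.
have [->|fy] := eqVneq (f y) 0; first by rewrite !mul0r.
apply: ler_wpM2l => //.
have xy : 0 < enorm (x - y).
  have [i xi] : exists i, (x - y) ord0 i != 0.
    apply/existsP; apply: contrapT => /negP; rewrite negb_exists => /forallP h.
    apply: yx; apply/rowP => i; have := h i; rewrite negbK !mxE subr_eq0 => /eqP.
    by [].
  exact: enorm_gt0 xi.
rewrite lef_pV2 ?posrE ?powR_gt0//; last exact: padded_gt0.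
apply: ge0_ler_powR; rewrite ?(ltW p0) ?nnegrE ?enorm_ge0//.
apply: padded_ge => i; rewrite !mxE.
rewrite (_ : _ - _ = - (y ord0 i - c ord0 i)); last by ring.
by rewrite normrN ltW// fc.
Qed.

Let riesz_measurable (f : rV -> R) : measurable_fun [set: rVL] f ->
  measurable_fun [set: rVL] (riesz l f).
Proof.
move=> mf; apply: measurable_funeM.
apply: (@measurable_integral_param _ _ rVL rVL R mu
  (fun z => f z.2 * (enorm (z.1 - z.2) `^ p)^-1)).
apply: (measurable_funM (f := fun z : rVL * rVL => f z.2)).
  by apply: (measurableT_comp mf); exact: measurable_snd.
exact: kernel_measurable.
Qed.

(** [k0] is any real number below [K c e], which may be infinite. *)
Let local_bound (c : rV) (e k0 : R) : 0 < e -> 0 <= k0 -> (k0%:E <= K c e)%E ->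
  {ae mu, forall y : rV, (forall i, `|y ord0 i - c ord0 i| < e) -> ga * k0 <= C * v y}.
Proof.
move=> e0 k00 kK.
have ei0 : 0 < e^-1 by rewrite invr_gt0.
pose phi := box_bump c e^-1.
have bumpP (y : rV) : (forall i, `|y ord0 i - c ord0 i| < e) <-> 0 < phi y.
  by rewrite -[e]invrK; exact: box_bump_gt0.
have tphi g : flat_alg g -> test_function (fun y => g y * phi y).
  by move=> ag; exact: test_function_box_bump.
have test_affine (f : rV -> R) : test_function f ->
    mu.-integrable setT (fun y => (f y * (C * v y - ga * k0))%:E) /\
    (\int[mu]_y (f y * (C * v y - ga * k0))%:E = C%:E * \int[mu]_y (f y * v y)%:E -
      (ga * k0)%:E * \int[mu]_y (f y * 1)%:E)%E.
  move=> tf; apply: integral_affine.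
    exact: test_function_integrableM.
  exact: test_function_integrableM (locally_integrable_cst 1).
have phiE : (fun y : rV => 1 * phi y) = phi by apply/funext => y; rewrite mul1r.
have tphi1 : test_function phi by rewrite -phiE; apply: tphi; exact: flat_alg_cst.
have [iw _] := test_affine _ tphi1.
(* The bump makes the weight integrable, so [ae_ge0_flat_alg] applies; where [phi] is positive it
   can be divided out. *)
have : {ae mu, forall y, 0 <= phi y * (C * v y - ga * k0)}.
  apply: (ae_ge0_flat_alg iw) => g ag g01.
  have tf := tphi _ ag.
  pose f y := g y * phi y.
  have f0 y : 0 <= f y by rewrite mulr_ge0 ?box_bump_ge0//; have /andP[] := g01 y.
  under eq_integral do rewrite mulrA.
  rewrite (test_affine _ tf).2.
  have i1 := test_function_integrableM tf (locally_integrable_cst 1).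
  have iv := test_function_integrableM tf vloc.
  have [F FE] : exists F : R, (\int[mu]_y (f y * 1)%:E = F%:E)%E.
    by exists (fine (\int[mu]_y (f y * 1)%:E)%E); rewrite fineK//; exact: (integrable_fin_num measurableT i1).
  have F0 : 0 <= F.
    by rewrite -lee_fin -FE; apply: integral_ge0 => y _; rewrite lee_fin mulr_ge0.
  have fc y : f y != 0 -> forall i, `|y ord0 i - c ord0 i| < e.
    move=> fy; apply/bumpP; rewrite lt_neqAle eq_sym box_bump_ge0 andbT.
    by apply: contraNN fy => /eqP fy; rewrite /f fy mulr0.
  have s0 : 0 <= ga * F by rewrite mulr_ge0// ltW.
  have h := weighted_norm_ge mu q0 s0 (riesz_measurable (test_function_measurable tf))
    (measurable_kap c e p) (kap_ge0 c e) uloc.1 u0 (riesz_ge e0 tf f0 fc FE).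
  (* Together with [riesz_ge], the hypothesis for [f = g * phi] gives [ga * F * K c e <= C] times
     the integral of [f v]. *)
  have {h} := le_trans h (H tf).
  rewrite (_ : (\int[mu]_x (`|f x| * v x)%:E = \int[mu]_x (f x * v x)%:E)%E); last first.
    by apply: eq_integral => y _; rewrite ger0_norm.
  move=> h; rewrite FE.
  have Vfin := integrable_fin_num measurableT iv.
  rewrite sube_ge0; last by rewrite -EFinM.
  apply: le_trans h; rewrite -EFinM mulrAC EFinM.
  by apply: lee_wpmul2l => //; rewrite lee_fin.
apply: (@filterS _ _ (ae_filter_ringOfSetsType mu)) => y Hy /bumpP phiy.
by move: Hy; rewrite pmulr_rge0// subr_ge0.
Qed.

Let cast (c : 'rV[rat]_N) : rV := map_mx ratr c.

(** Each cube and each truncation level has its own exceptional null set. Rational centres,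
    half-sides [m.+1^-1] and natural levels [n] leave countably many, coded by [pickle], so one null
    set serves for all. *)
Let uniform_bound : {ae mu, forall y : rV, forall (c : 'rV[rat]_N) (m : nat),
  (forall i, `|y ord0 i - ratr (c ord0 i)| < m.+1%:R^-1) ->
  (K (cast c) m.+1%:R^-1 <= (C * v y / ga)%:E)%E}.
Proof.
have K0 c e : (0 <= K c e)%E by exact: poweR_ge0.
pose P (k : nat) (y : rVL) : Prop :=
  if unpickle k is Some (c, m, n) then
    (forall i, `|y ord0 i - cast c ord0 i| < m.+1%:R^-1) ->
    ga * fine (Order.min (K (cast c) m.+1%:R^-1) n%:R%:E) <= C * v y else True.
have aeP : {ae mu, forall y, forall k, P k y}.
  apply: ae_foralln => k; rewrite /P; case: unpickle => [[[c m] n]|]; last exact: aeW.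
  have m0 : (0 <= Order.min (K (cast c) m.+1%:R^-1) n%:R%:E)%E.
    by rewrite le_min K0 lee_fin ler0n.
  apply: local_bound; rewrite ?invr_gt0 ?fine_ge0//.
  rewrite fineK; first by rewrite ge_min lexx.
  rewrite ge0_fin_numE//; apply: (@le_lt_trans _ _ n%:R%:E); last exact: ltry.
  by rewrite ge_min lexx orbT.
apply: (@filterS _ _ (ae_filter_ringOfSetsType mu)) aeP => y Hy c m ycm.
apply: min_nat_le => // n; have := Hy (pickle (c, m, n)).
rewrite /P pickleK; apply => i; rewrite mxE; exact: ycm.
Qed.

Lemma riesz_weighted_necessary : {ae mu, forall y,
  ((\int[mu]_x (u x / enorm (x - y) `^ ((N%:R - l) * q))%:E) `^ q^-1
        <= (C / ga)%:E * (v y)%:E)%E}.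
Proof.
apply: (@filterS _ _ (ae_filter_ringOfSetsType mu)) uniform_bound => y Hy.
set V := C * v y / ga in Hy.
have V0 : 0 <= V.
  apply: divr_ge0; last exact: ltW.
  by apply: mulr_ge0; [exact: ltW|exact: v0].
have pq0 : 0 < p * q by rewrite mulr_gt0.
pose e (m : nat) : R := m.+1%:R^-1.
have e0 m : 0 < e m by rewrite invr_gt0.
have mS : measurable ([set y] : set rVL) by apply: compact_rV_measurable; exact: compact_set1.
(* The indicator removes [x = y], where the padded kernels blow up as [m] grows while the limit
   kernel is 0 by convention. The doubled padding comes from [padded_shift]. *)
pose f (m : nat) (x : rV) : R :=
  \1_(~` [set y]) x * (u x * (enorm (padded (e m + e m) (x - y)) `^ (p * q))^-1).
have f0 m x : 0 <= f m x.
  by rewrite !mulr_ge0 ?invr_ge0 ?powR_ge0.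
have mf m : measurable_fun [set: rVL] (f m).
  apply: measurable_funM; first by apply: measurable_indic; exact: measurableC.
  by apply: measurable_funM; [exact: uloc.1|exact: measurable_kap].
have cvf x : (f m x)%:E @[m --> \oo] --> (u x / enorm (x - y) `^ (p * q))%:E.
  apply: cvg_EFin; first exact: nearW.
  rewrite /f; have [->|xy] := eqVneq x y.
    rewrite subrr enorm0 powR0 ?gt_eqF// invr0 mulr0 indicE memNset; last by move=> /= ; apply.
    by under eq_fun do rewrite mul0r; exact: cvg_cst.
  rewrite indicE mem_set; last by move=> /= /eqP; apply/negP.
  under eq_fun do rewrite mul1r.
  have [i xi] : exists i, (x - y) ord0 i != 0.
    apply/existsP; apply: contraNT xy; rewrite negb_exists => /forallP h.
    by apply/eqP/rowP => i; have := h i; rewrite negbK !mxE subr_eq0 => /eqP.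
  have exy := enorm_gt0 xi.
  apply: cvgM; first exact: cvg_cst.
  apply: cvgV; first by rewrite gt_eqF// powR_gt0.
  have ce : e m + e m @[m --> \oo] --> (0 : R).
    rewrite -[X in _ --> X]addr0; apply: cvgD; exact: cvg_harmonic.
  have cp := @padded_cvg _ _ _ (x - y) ce.
  have c1 : {for enorm (x - y), continuous (fun t : R => t `^ (p * q))}.
    apply: differentiable_continuous; apply/derivable1_diffP.
    by apply: derivable_powR; rewrite in_itv/= andbT.
  exact: (cvg_comp _ _ cp c1).
have fV m : (\int[mu]_x (f m x)%:E <= (V `^ q)%:E)%E.
  (* Some rational cube of half-side [e m] contains [y], and its [kap] dominates the kernel padded
     by [e m + e m] around [y]; so the bound by [V] holds for every [m]. *)
  have [c yc] := rat_rV_approx y (e0 m).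
  have KV := Hy c m yc.
  have I0 : (0 <= \int[mu]_x (kap (cast c) (e m) x `^ q * u x)%:E)%E.
    by apply: integral_ge0 => x _; rewrite lee_fin mulr_ge0 ?powR_ge0.
  have := @gt0_ler_poweR _ q (ltW q0) _ _ _ _ KV.
  rewrite !in_itv/= !leey !andbT poweR_ge0 lee_fin V0 => /(_ isT isT).
  rewrite /K -poweRrM mulVf ?gt_eqF// poweRe1//.
  apply: le_trans; apply: ge0_le_integral.
  - exact: measurableT.
  - by move=> x _; rewrite lee_fin.
  - exact/measurable_EFinP.
  - apply/measurable_EFinP; apply: measurable_funM; last exact: uloc.1.
    apply: (measurableT_comp (measurable_powR q)); exact: measurable_kap.
  - move=> x _; rewrite lee_fin /f /kap powR_invM mulrC.
    apply: (@le_trans _ _ (u x * (enorm (padded (e m + e m) (x - y)) `^ (p * q))^-1)).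
      by rewrite ler_piMr ?mulr_ge0 ?invr_ge0 ?powR_ge0.
    rewrite mulrC; apply: ler_wpM2r => //.
    rewrite lef_pV2 ?posrE ?powR_gt0 ?padded_gt0 ?addr_gt0//.
    apply: ge0_ler_powR; rewrite ?(ltW pq0) ?nnegrE ?enorm_ge0//.
    apply: padded_shift => i; rewrite !mxE.
    rewrite (_ : _ - _ = y ord0 i - ratr (c ord0 i)); last by ring.
    by rewrite ltW// yc.
have IV : (\int[mu]_x (u x / enorm (x - y) `^ (p * q))%:E <= (V `^ q)%:E)%E.
  apply: (@fatou_le _ rVL R mu (fun m x => (f m x)%:E)
    (fun x => (u x / enorm (x - y) `^ (p * q))%:E) _ _ _ cvf fV).
    by move=> m; exact/measurable_EFinP.
  by move=> m x; rewrite lee_fin.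
have qi0 : 0 <= q^-1 by rewrite invr_ge0 ltW.
have I0 : (0 <= \int[mu]_x (u x / enorm (x - y) `^ (p * q))%:E)%E.
  by apply: integral_ge0 => x _; rewrite lee_fin mulr_ge0 ?invr_ge0 ?powR_ge0.
have := @gt0_ler_poweR _ q^-1 qi0 _ _ _ _ IV.
rewrite !in_itv/= !leey !andbT I0 lee_fin powR_ge0 => /(_ isT isT) h.
apply: (le_trans h); rewrite -powRrM mulfV ?gt_eqF// powRr1// -EFinM lee_fin.
by rewrite /V mulrAC.
Qed.

End necessity.

(** In both directions the constants are related by [C = riesz_cst N l * C'], so the best constants
    differ exactly by this factor. *)
Theorem theorem1p2 (R : realType) (N : nat) (l q : R) (u v : 'rV[R]_N -> R)
    (N_ge1 : (1 <= N)%N) (l_gt0 : 0 < l) (l_ltN : l < N%:R) (q_gt1 : 1 < q)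
    (u_ge0 : forall x, 0 <= u x) (v_ge0 : forall x, 0 <= v x)
    (u_loc : locally_integrable_rV u) (v_loc : locally_integrable_rV v) :
  (exists2 C : R, 0 < C &
    forall f : 'rV[R]_N -> R, test_function f ->
      ((\int[lebesgue_rV N]_x (`|riesz l f x| `^ q * (u x)%:E)) `^ q^-1
        <= C%:E * \int[lebesgue_rV N]_x (`|f x| * v x)%:E)%E)
  <->
  (exists2 C' : R, 0 < C' &
    {ae lebesgue_rV N, forall y,
      ((\int[lebesgue_rV N]_x (u x / enorm (x - y) `^ ((N%:R - l) * q))%:E)
          `^ q^-1
        <= C'%:E * (v y)%:E)%E}).
Proof.
have g0 := riesz_cst_gt0 l_gt0 l_ltN.
split=> [[C C0 H]|[C C0 H]].
  exists (C / riesz_cst N l); first exact: divr_gt0.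
  exact: riesz_weighted_necessary.
exists (riesz_cst N l * C); first exact: mulr_gt0.
by move=> f; exact: riesz_weighted_bound.
Qed.
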